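(* Let $A\in\mathbb{R}^{d\times d}$ be symmetric positive semidefinite with eigenvalues $1\ge\lambda_1>\lambda_2\ge\cdots\ge\lambda_d\ge0$ and orthonormal eigenvectors $u_1,\dots,u_d$. Run the Variance-Reduced Power Method with Momentum (defined in the context) with $2\sqrt\beta\in[\lambda_2,\lambda_1)$ and an initial unit vector $w_0$ such that $1-(u_1^Tw_0)^2\le\frac12$. Let $c\in(0,1/16)$ be a numerical constant. For any $\delta,\epsilon\in(0,1)$, if $$T=\frac{\sqrt\beta}{\sqrt{\lambda_1^2-4\beta}}\log\left(\frac1{c\delta}\right),\qquad s\ge\frac{32\sqrt d\sqrt\beta\,\sigma^2}{c(\lambda_1^2-4\beta)^{3/2}\delta}\log\left(\frac1{c\delta}\right),$$ then after $K=O(\log(1/\epsilon))$ epochs (with an absolute implied constant), with probability at least $1-\log\left(\frac1\epsilon\right)\delta$, the resulting iterate satisfies $1-(u_1^T\tilde w_K)^2\le\epsilon$.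
   Context: $\|\cdot\|$ is the Euclidean norm for vectors and the spectral norm for matrices. There is a stream of i.i.d. random matrices $\tilde A\in\mathbb{R}^{d\times d}$ with $\mathbb{E}[\tilde A]=A$, $\|\tilde A\|\le r$ almost surely for some constant $r$, and $\mathbb{E}\|\tilde A-A\|^2=\sigma^2$. Exact products $A\tilde w$ are available once per epoch. Variance-Reduced Power Method with Momentum (inputs: initial unit vector $w_0$, epoch length $T$, batch size $s$, momentum parameter $\beta$, number of epochs $K$): set $\tilde w_0=w_0$. Given the unit vector (anchor) $\tilde w_k$, one epoch produces $\tilde w_{k+1}$ as follows: start with $w_{-1}=0$ and $w_0=\tilde w_k$; for each of $T$ inner iterations $t=0,\dots,T-1$, draw $s$ fresh i.i.d. samples $\tilde A_{t_1},\dots,\tilde A_{t_s}$, put $\alpha=w_t^T\tilde w_k$, set $$w_{t+1}\leftarrow\frac1s\sum_{i=1}^s\tilde A_{t_i}(w_t-\alpha\tilde w_k)+\alpha A\tilde w_k-\beta w_{t-1},$$ and normalize simultaneously $w_t\leftarrow w_t/\|w_{t+1}\|$, $w_{t+1}\leftarrow w_{t+1}/\|w_{t+1}\|$. Then $\tilde w_{k+1}=w_T$. After $K$ epochs the iterate is $\tilde w_K$.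
   Formalization: T is taken as the least positive integer at least the stated formula: the formula is rounded up, and when β=0 (where it gives T=0 and the iterate would never move, so the claim fails) T=1 is used. *)

(* Defs.v *)
From HB Require Import structures.
From mathcomp Require Import all_boot all_order all_algebra.
From mathcomp Require Import all_classical all_reals all_analysis.
Set Implicit Arguments.
Unset Strict Implicit.
Unset Printing Implicit Defensive.
Import Order.TTheory GRing.Theory Num.Theory.
Import numFieldNormedType.Exports.
Local Open Scope classical_set_scope.
Local Open Scope ring_scope.

Section linear_algebra.
Context {R : realType}.

Definition dotv d (x y : 'cV[R]_d) : R := (x^T *m y) 0 0.

(* The library norm `|x| on matrices is the max norm, hence these two norms. *)
Definition norm2 d (x : 'cV[R]_d) : R := Num.sqrt (dotv x x).

Definition spectral_norm d (M : 'M[R]_d) : R :=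
  sup [set norm2 (M *m x) | x in [set x : 'cV[R]_d | norm2 x <= 1]].

Definition psd d (M : 'M[R]_d) : Prop :=
  M^T = M /\ forall x : 'cV[R]_d, 0 <= dotv x (M *m x).

Definition orthonormal_family d (u : 'I_d -> 'cV[R]_d) : Prop :=
  forall i j, dotv (u i) (u j) = (i == j)%:R.

End linear_algebra.

Section random_matrices.
Context {R : realType} {dT : measure_display} {Omega : measurableType dT}.
Variable P : probability Omega R.

Definition mx_borel d : set (set 'M[R]_d) := <<s @open 'M[R]_d >>.

Definition random_mx d (X : Omega -> 'M[R]_d) : Prop :=
  forall B, mx_borel B -> measurable (X @^-1` B).

Definition identically_distributed d (X : nat -> Omega -> 'M[R]_d) : Prop :=
  forall n B, mx_borel B -> P (X n @^-1` B) = P (X 0 @^-1` B).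

Definition mutually_independent d (X : nat -> Omega -> 'M[R]_d) : Prop :=
  forall (J : seq nat) (B : nat -> set 'M[R]_d),
    uniq J -> (forall j, mx_borel (B j)) ->
    P (\bigcap_(j in [set` J]) (X j @^-1` B j)) =
    (\big[*%E/1]_(j <- J) P (X j @^-1` B j))%E.

Definition iid d (X : nat -> Omega -> 'M[R]_d) : Prop :=
  [/\ forall n, random_mx (X n), identically_distributed X
    & mutually_independent X].

Definition mx_mean d (X : Omega -> 'M[R]_d) (A : 'M[R]_d) : Prop :=
  forall i j, ('E_P[fun w => X w i j] = (A i j)%:E)%E.

End random_matrices.

Section vr_power_momentum.
Context {R : realType} (d : nat).
Implicit Types (A M : 'M[R]_d) (a : 'cV[R]_d).

(* One inner iteration on the pair (w_{t-1}, w_t), with anchor a and batch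
   mean M. If w_{t+1} = 0 the normalization is undefined in the algorithm;
   since 0^-1 = 0, both vectors (and all later iterates) are then 0, so
   1 - (u_1^T w)^2 = 1 and such a run never counts as accurate. *)
Definition vr_step A (beta : R) a M (w : 'cV[R]_d * 'cV[R]_d) :=
  let alpha := dotv w.2 a in
  let w' := M *m (w.2 - alpha *: a) + alpha *: (A *m a) - beta *: w.1 in
  ((norm2 w')^-1 *: w.2, (norm2 w')^-1 *: w').

Fixpoint vr_inner A (beta : R) (M : nat -> 'M[R]_d) a (t : nat) :=
  if t is t'.+1 then vr_step A beta a (M t') (vr_inner A beta M a t')
  else (0, a).

(* Mean of the b-th batch of s consecutive elements of the sample stream S. *)
Definition batch_mean (s : nat) (S : nat -> 'M[R]_d) (b : nat) : 'M[R]_d :=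
  s%:R^-1 *: \sum_(i < s) S (b * s + i)%N.

(* Anchor after k epochs; the t-th inner iteration of epoch k uses batch
   k * T + t, so that no element of the stream is used twice. *)
Fixpoint vr_power A (beta : R) (T s : nat) (S : nat -> 'M[R]_d)
    (w0 : 'cV[R]_d) (k : nat) : 'cV[R]_d :=
  if k is k'.+1 then
    (vr_inner A beta (fun t => batch_mean s S (k' * T + t)%N)
       (vr_power A beta T s S w0 k') T).2
  else w0.

End vr_power_momentum.

(* The number of inner iterations is the least positive integer that is at
   least sqrt beta / sqrt (lambda1^2 - 4 beta) * log (1 / (c delta)). *)
Definition epoch_length {R : realType} (beta lambda1 c delta : R) : nat :=
  maxn 1 `|Num.ceil (Num.sqrt beta / Num.sqrt (lambda1 ^+ 2 - 4 * beta)
                     * ln (1 / (c * delta)))|%N.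

(* Main.v *)
Require Import Defs.
From HB Require Import structures.
From mathcomp Require Import all_boot all_order all_algebra.
From mathcomp Require Import all_classical all_reals all_analysis measurable_realfun.
From mathcomp Require Import ring lra zify.
Set Implicit Arguments.
Unset Strict Implicit.
Unset Printing Implicit Defensive.
Import Order.TTheory GRing.Theory Num.Theory.
Import numFieldNormedType.Exports.
Local Open Scope classical_set_scope.
Local Open Scope ring_scope.

(** Up to normalization an epoch is the three-term recurrence
    y_{t+1} = A y_t - beta y_{t-1} + E_t (I - a a^T) y_t driven by the batch
    noise E_t, so y_T is the scaled Chebyshev polynomial p_T(A) applied to the
    anchor a plus a sum of martingale differences weighted by p_{T-1-t}(A).
    Since p_T damps every eigenvalue in [0, 2 sqrt beta] relative to lambda_1,
    the squared tangent of the angle between u_1 and the anchor contracts; since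
    the noise only sees (I - a a^T) y_t, its second moment is at most delta
    times a small constant times that squared tangent.

    The iterates must also never vanish inside an epoch. The growing mode
    l_t = u_1^T y_t - z_- u_1^T y_{t-1} satisfies l_{t+1} = z_+ l_t + noise and
    l_t > 0 for all t forces u_1^T y_t > 0. Switching the noise off once
    l_t <= 0 leaves the second moments valid and turns "l_t <= 0 for some t"
    into the single event l_T <= 0, to which Chebyshev's inequality applies.

    Over the epochs, the expected squared tangent on the surviving event decays
    geometrically, so the failure probabilities of the successive epochs, each
    at most a constant times delta times this expectation, sum to less than
    (27/40) delta <= delta log 2, however many epochs are run. *)

(** * Independence *)

(** About 40 log(1/epsilon) epochs are run, so a union bound at delta per epoch would overshoot the
    allowed failure probability. Moreover the expected squared tangent decays without a factor
    delta, so Markov's inequality applied to it at the last epoch is too weak. What is bounded there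
    is its excess over the deterministic sequence (72/100)^k: the excess starts at 0 and is fed only
    by noise, hence is of order delta (8/10)^k.

    Each epoch is started from phi times the anchor, where phi is a random weight known when the
    epoch begins. All pathwise bounds are homogeneous in phi, so a weight proportional to 1/(u_1^T
    a) makes the signal deterministic before expectations are taken, and phi = 0 discards the runs
    that have already failed.

    Budget: the relative noise of an epoch is at most delta/180 times the weighted defect 1 - (u_1^T
    a)^2. Losing a run ever costs at most (6/10) delta, the final excess costs delta/50, and 6/10 +
    1/50 < 27/40 <= log 2. *)

Section independence.
Context {R : realType} {dT : measure_display} {Omega : measurableType dT}.
Variable P : probability Omega R.

Lemma sub_sigma_algebra_measurable (G : set (set Omega)) :
  G `<=` measurable -> <<s G >> `<=` measurable.
Proof.
move=> Gm; apply: smallest_sub => //; exact: sigma_algebra_measurable.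
Qed.

(** Dynkin's pi-lambda argument: the events independent of [B] form a Dynkin system containing the
    pi-system [G]. *)
Lemma indep_event_generated (G : set (set Omega)) (B : set Omega) :
  setI_closed G -> G `<=` measurable -> measurable B ->
  (forall A, G A -> P (A `&` B) = (P A * P B)%E) ->
  forall A, <<s G >> A -> P (A `&` B) = (P A * P B)%E.
Proof.
move=> GI Gm mB GP A; rewrite -setI_closed_g_dynkin_g_sigma_algebra//.
pose H := [set A | measurable A /\ P (A `&` B) = (P A * P B)%E].
suff dH : dynkin H by move=> /(_ H) []; [split => // ? ?; split; auto|].
split.
- by split => //; rewrite setTI probability_setT mul1e.
- move=> E [mE PE]; split; first exact: measurableC.
  transitivity (P B - P (E `&` B))%E.
    by rewrite setIC -setDE measureD//= ?[E `&` B]setIC// ltey_eq fin_num_measure.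
  rewrite PE probability_setC//.
  by rewrite muleBl ?fin_num_measure// ?mul1e// fin_num_adde_defr// fin_num_measure.
- move=> F tF HF.
  have mF n : measurable (F n) by have [] := HF n.
  split; first exact: bigcup_measurable.
  rewrite setI_bigcupl measure_bigcup//=; last 2 first.
    by move=> n _; exact: measurableI.
    by apply: trivIset_setIr.
  have PBK : ((fine (P B))%:E = P B)%E by rewrite fineK// fin_num_measure.
  rewrite measure_bigcup// -PBK muleC -nneseriesZl//.
  by apply: eq_eseriesr => n _; rewrite PBK muleC; have [] := HF n.
Qed.

(* The joint law of (i1, i2) is the product of the two laws. *)
Lemma indep_Rintegral_mul d1 d2 (T1 : measurableType d1) (T2 : measurableType d2)
    (i1 : Omega -> T1) (i2 : Omega -> T2) (f : T1 -> R) (g : T2 -> R) :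
  measurable_fun setT i1 -> measurable_fun setT i2 ->
  (forall A B, measurable A -> measurable B ->
     P (i1 @^-1` A `&` i2 @^-1` B) = (P (i1 @^-1` A) * P (i2 @^-1` B))%E) ->
  measurable_fun setT f -> measurable_fun setT g ->
  P.-integrable setT (EFin \o (f \o i1)) ->
  P.-integrable setT (EFin \o (g \o i2)) ->
  P.-integrable setT (EFin \o (fun w => f (i1 w) * g (i2 w))) ->
  Rintegral P setT (fun w => f (i1 w) * g (i2 w)) =
  Rintegral P setT (f \o i1) * Rintegral P setT (g \o i2).
Proof.
move=> mi1 mi2 ind mf mg intf intg intfg.
pose phi w := (i1 w, i2 w).
have mphi : measurable_fun setT phi by exact: measurable_fun_pair.
pose X1 : {mfun Omega >-> T1} := HB.pack i1 (isMeasurableFun.Build _ _ _ _ _ mi1).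
pose X2 : {mfun Omega >-> T2} := HB.pack i2 (isMeasurableFun.Build _ _ _ _ _ mi2).
pose X12 : {mfun Omega >-> (T1 * T2)%type} :=
  HB.pack phi (isMeasurableFun.Build _ _ _ _ _ mphi).
pose m1 := distribution P X1; pose m2 := distribution P X2.
have prodE A : measurable A -> (m1 \x m2)%E A = distribution P X12 A.
  apply: product_measure_unique => B C mB mC.
  by rewrite /= /m1 /m2 /distribution /pushforward /= -ind.
pose h z := ((f z.1 * g z.2)%:E : \bar R).
have mh : measurable_fun setT h.
  apply/measurable_EFinP; apply: measurable_funM => /=.
    exact: (measurableT_comp mf).
  exact: (measurableT_comp mg).
have mf1 : measurable_fun setT (EFin \o f) by exact/measurable_EFinP.
have mg1 : measurable_fun setT (EFin \o g) by exact/measurable_EFinP.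
have inth : (m1 \x m2)%E.-integrable setT h.
  apply/integrableP; split => //.
  rewrite (@eq_measure_integral _ _ _ _ (distribution P X12)); last first.
    by move=> A mA _; exact: prodE.
  rewrite ge0_integral_distribution//; last exact: measurableT_comp.
  by have /integrableP[] := intfg.
rewrite /Rintegral.
have -> : (\int[P]_x (f (i1 x) * g (i2 x))%:E = \int[m1 \x m2]_z h z)%E.
  rewrite (@eq_measure_integral _ _ _ _ (distribution P X12)); last first.
    by move=> A mA _; exact: prodE.
  by rewrite integral_distribution.
rewrite -integral12_prod_meas1//=.
have fE : (\int[m1]_x (EFin \o f) x = \int[P]_x (f (i1 x))%:E)%E.
  by rewrite integral_distribution.
have gE : (\int[m2]_x (EFin \o g) x = \int[P]_x (g (i2 x))%:E)%E.
  by rewrite integral_distribution.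
have intg2 : m2.-integrable setT (EFin \o g) by exact: integrable_pushforward.
have gfin : (\int[P]_x (g (i2 x))%:E = (fine (\int[P]_x (g (i2 x))%:E))%:E)%E.
  by rewrite fineK//; exact: integrable_fin_num.
transitivity (fine (\int[m1]_x
    ((fine (\int[P]_w (g (i2 w))%:E))%:E * (EFin \o f) x)))%E.
  congr fine; apply: eq_integral => x _; rewrite /h /=.
  transitivity (\int[m2]_y ((f x)%:E * (EFin \o g) y))%E; first by [].
  by rewrite integralZl// gE gfin /= muleC.
rewrite integralZl//=; last exact: integrable_pushforward.
rewrite [X in fine (_ * X)]fE fineM//; last exact: integrable_fin_num.
exact: mulrC.
Qed.
End independence.

(** * Bounded random variables adapted to the sample stream *)

Section bounded_adapted.
Context {R : realType} {dT : measure_display} {Omega : measurableType dT}.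
Variables (P : probability Omega R) (d : nat) (X : nat -> Omega -> 'M[R]_d).

(** Cylinder events of the first [n] samples. They form a pi-system on which mutual independence
    applies directly; [adapted] refers to the sigma-algebra they generate. *)
Definition past (n : nat) : set (set Omega) :=
  [set A | exists B : nat -> set 'M[R]_d, (forall j, mx_borel (B j)) /\
     A = \bigcap_(j in [set` iota 0 n]) (X j @^-1` B j)].

(** Almost sure boundedness, because the samples are bounded by [r] only almost surely. Together
    with measurability it makes every integrand below integrable. *)
Definition ess_bounded (f : Omega -> R) :=
  exists M, {ae P, forall w, `|f w| <= M}.

Definition adapted (n : nat) (f : Omega -> R) :=
  measurable_fun (setT : set (g_sigma_algebraType (past n))) f.

Definition bdd_adapted (n : nat) (f : Omega -> R) := adapted n f /\ ess_bounded f.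

Lemma mx_borelI : setI_closed (@mx_borel R d).
Proof.
by move=> A B; exact: (@measurableI _ (g_sigma_algebraType (@open 'M[R]_d))).
Qed.

Lemma mx_borelT : mx_borel [set: 'M[R]_d].
Proof. exact: (@measurableT _ (g_sigma_algebraType (@open 'M[R]_d))). Qed.

Lemma setI_closed_past n : setI_closed (past n).
Proof.
move=> _ _ [B [mB ->]] [C [mC ->]]; exists (fun j => B j `&` C j); split.
  by move=> j; exact: mx_borelI.
by rewrite -bigcapI; apply: eq_bigcapr => j _; rewrite preimage_setI.
Qed.

Lemma ess_bounded_cst c : ess_bounded (fun=> c).
Proof. by exists `|c|; apply: aeW. Qed.

Lemma ess_boundedD f g :
  ess_bounded f -> ess_bounded g -> ess_bounded (fun w => f w + g w).
Proof.
move=> [M fM] [N gN]; exists (M + N); apply: filterS2 fM gN => w fw gw.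
by rewrite (le_trans (ler_normD _ _))// lerD.
Qed.

Lemma ess_boundedM f g :
  ess_bounded f -> ess_bounded g -> ess_bounded (fun w => f w * g w).
Proof.
move=> [M fM] [N gN]; exists (M * N); apply: filterS2 fM gN => w fw gw.
by rewrite normrM ler_pM.
Qed.

Lemma bdd_adapted_cst n c : bdd_adapted n (fun=> c).
Proof. by split; [exact: measurable_cst|exact: ess_bounded_cst]. Qed.

Lemma bdd_adaptedD n f g : bdd_adapted n f -> bdd_adapted n g ->
  bdd_adapted n (fun w => f w + g w).
Proof.
move=> [mf bf] [mg bg]; split; [exact: measurable_funD|exact: ess_boundedD].
Qed.

Lemma bdd_adaptedM n f g : bdd_adapted n f -> bdd_adapted n g ->
  bdd_adapted n (fun w => f w * g w).
Proof.
move=> [mf bf] [mg bg]; split; [exact: measurable_funM|exact: ess_boundedM].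
Qed.

Lemma bdd_adaptedZ n c f : bdd_adapted n f -> bdd_adapted n (fun w => c * f w).
Proof. by apply: bdd_adaptedM; exact: bdd_adapted_cst. Qed.

Lemma bdd_adaptedN n f : bdd_adapted n f -> bdd_adapted n (fun w => - f w).
Proof. by move=> /(bdd_adaptedZ (-1)); under eq_fun do rewrite mulN1r. Qed.

Lemma bdd_adaptedB n f g : bdd_adapted n f -> bdd_adapted n g ->
  bdd_adapted n (fun w => f w - g w).
Proof. by move=> bf /bdd_adaptedN; exact: bdd_adaptedD. Qed.

Lemma bdd_adaptedX n f : bdd_adapted n f -> bdd_adapted n (fun w => f w ^+ 2).
Proof. by move=> bf; under eq_fun do rewrite expr2; exact: bdd_adaptedM. Qed.

Lemma bdd_adapted_sum n (I : Type) (r : seq I) (Q : pred I) (F : I -> Omega -> R) :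
  (forall i, Q i -> bdd_adapted n (F i)) ->
  bdd_adapted n (fun w => \sum_(i <- r | Q i) F i w).
Proof.
move=> bF; elim: r => [|i r IH].
  by under eq_fun do rewrite big_nil; exact: bdd_adapted_cst.
under eq_fun do rewrite big_cons.
have [Qi|//] := boolP (Q i); apply: bdd_adaptedD => //; exact: bF.
Qed.

Lemma adapted_comp n (h : R -> R) f : measurable_fun setT h -> adapted n f ->
  adapted n (h \o f).
Proof. by move=> mh mf; exact: measurableT_comp. Qed.

Lemma bdd_adapted_pos n f : adapted n f -> bdd_adapted n (fun w => (0 < f w)%R%:R).
Proof.
move=> mf; split; last first.
  exists 1; apply: aeW => w; case: (0 < f w)%R => //=; last by rewrite normr0.
  by rewrite normr1.
have -> : (fun w => (0 < f w)%R%:R : R) = \1_[set x : R | 0 < x] \o f.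
  by apply/funext => w; rewrite /= indicE mem_setE.
apply: adapted_comp => //; apply: measurable_indic.
by rewrite -set_itvoy; exact: measurable_itv.
Qed.


Lemma past_le m n : (m <= n)%N -> past m `<=` past n.
Proof.
move=> mn _ [B [mB ->]]; exists (fun j => if (j < m)%N then B j else setT); split.
  by move=> j; case: ifP => // _; exact: mx_borelT.
apply/seteqP; split => w H j /=; rewrite mem_iota/= add0n => jn.
  by case: ifPn => // jm; apply: H; rewrite /= mem_iota.
have := H j; rewrite /= mem_iota/= add0n jn; apply.
exact: leq_trans jn mn.
Qed.

Lemma adapted_le m n f : (m <= n)%N -> adapted m f -> adapted n f.
Proof.
move=> mn mf _ B mB; have := mf measurableT B mB.
apply: (@sub_smallest2r _ (sigma_algebra setT)); last exact: past_le.
exact: smallest_sigma_algebra.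
Qed.

Lemma bdd_adapted_le m n f : (m <= n)%N -> bdd_adapted m f -> bdd_adapted n f.
Proof. by move=> mn [mf bf]; split => //; exact: adapted_le mf. Qed.

Hypothesis rX : forall n, random_mx (X n).

Lemma past_measurable n : past n `<=` measurable.
Proof.
move=> _ [B [mB ->]]; apply: fin_bigcap_measurable; first exact: finite_seq.
by move=> j _; exact: rX.
Qed.

Lemma adapted_measurable n f : adapted n f -> measurable_fun setT f.
Proof.
move=> mf _ B mB; apply: (sub_sigma_algebra_measurable (@past_measurable n)).
exact: mf.
Qed.

Lemma mx_borel_entry i j (B : set R) : measurable B ->
  mx_borel ((fun M : 'M[R]_d => M i j) @^-1` B).
Proof.
pose M := g_sigma_algebraType (@open 'M[R]_d).
suff mf : measurable_fun setT (fun m : M => m i j).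
  by move=> mB; have := mf measurableT B mB; rewrite setTI.
apply: (measurability (@RGenInftyO.G R)); first exact: RGenInftyO.measurableE.
move=> _ [_ [x ->] <-]; rewrite setTI; apply: sub_sigma_algebra.
apply: open_comp; last exact: interval_open.
by move=> m _; exact: coord_continuous.
Qed.

Lemma integrable_ess_bounded f : measurable_fun setT f -> ess_bounded f ->
  P.-integrable setT (EFin \o f).
Proof.
move=> mf [M fM]; apply/integrableP; split; first exact/measurable_EFinP.
apply: (@le_lt_trans _ _ (`|M|%:E * P setT)%E); last first.
  by rewrite probability_setT mule1 ltry.
apply: integral_le_bound => //; first exact/measurable_EFinP.
by apply: filterS fM => w fw _; rewrite /= lee_fin (le_trans fw (ler_norm M)).
Qed.

Lemma integrable_bdd n f : bdd_adapted n f -> P.-integrable setT (EFin \o f).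
Proof.
move=> [mf bf]; apply: integrable_ess_bounded => //; exact: adapted_measurable mf.
Qed.

Definition Ex (f : Omega -> R) := Rintegral P setT f.

Lemma ExD n f g : bdd_adapted n f -> bdd_adapted n g ->
  Ex (fun w => f w + g w) = Ex f + Ex g.
Proof. move=> bf bg; apply: RintegralD => //.
  exact: (integrable_bdd bf).
exact: (integrable_bdd bg). Qed.

Lemma ExZ n c f : bdd_adapted n f -> Ex (fun w => c * f w) = c * Ex f.
Proof. by move=> bf; apply: RintegralZl => //; exact: (integrable_bdd bf). Qed.

Lemma Ex_cst c : Ex (fun=> c) = c.
Proof. have P1 : fine (P setT) = 1 by rewrite probability_setT.
by rewrite /Ex Rintegral_cst// [X in _ * X]P1 mulr1. Qed.

Lemma Ex_le n f g : bdd_adapted n f -> bdd_adapted n g ->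
  (forall w, f w <= g w) -> Ex f <= Ex g.
Proof.
move=> bf bg fg; apply: le_Rintegral => //.
  exact: (integrable_bdd bf).
exact: (integrable_bdd bg).
Qed.

Lemma Ex_ge0 f : (forall w, 0 <= f w) -> 0 <= Ex f.
Proof. by move=> f0; exact: Rintegral_ge0. Qed.

Lemma Ex_sum n (I : Type) (r : seq I) (Q : pred I) (F : I -> Omega -> R) :
  (forall i, Q i -> bdd_adapted n (F i)) ->
  Ex (fun w => \sum_(i <- r | Q i) F i w) = \sum_(i <- r | Q i) Ex (F i).
Proof.
move=> bF; elim: r => [|i r IH].
  by rewrite big_nil -[RHS](Ex_cst 0); congr Ex; apply/funext => w; rewrite big_nil.
rewrite big_cons -IH; have [Qi|nQi] := boolP (Q i); last first.
  by congr Ex; apply/funext => w; rewrite big_cons (negbTE nQi).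
rewrite -(@ExD n); [|exact: bF|exact: bdd_adapted_sum].
by congr Ex; apply/funext => w; rewrite big_cons Qi.
Qed.

Hypothesis iX : mutually_independent P X.

Lemma indep_past n A B : past n A -> mx_borel B ->
  P (A `&` X n @^-1` B) = (P A * P (X n @^-1` B))%E.
Proof.
move=> [C [mC ->]] mB.
pose C' j := if j == n then B else C j.
have mC' j : mx_borel (C' j) by rewrite /C'; case: ifP.
have CE : \bigcap_(j in [set` iota 0 n]) (X j @^-1` C' j) =
          \bigcap_(j in [set` iota 0 n]) (X j @^-1` C j).
  apply: eq_bigcapr => j /=; rewrite mem_iota/= add0n /C' => jn.
  by rewrite ltn_eqF.
have un : uniq (n :: iota 0 n) by rewrite /= mem_iota/= add0n ltnn iota_uniq.
have := iX un mC'; rewrite big_cons -(iX (iota_uniq 0 n) mC') CE.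
have -> : \bigcap_(j in [set` n :: iota 0 n]) (X j @^-1` C' j) =
          (X n @^-1` B) `&` \bigcap_(j in [set` iota 0 n]) (X j @^-1` C' j).
  apply/seteqP; split => [w H|w [Hn H] j /=].
    split; first by have := H n; rewrite /C' eqxx; apply; rewrite /= inE eqxx.
    by move=> j jn; apply: H; rewrite /= inE; apply/orP; right.
  by rewrite inE => /orP[/eqP->|/H//]; rewrite /C' eqxx.
by rewrite CE {1}/C' eqxx setIC muleC.
Qed.

Lemma Ex_indep n f (g : 'M[R]_d -> R) : bdd_adapted n f ->
  measurable_fun (setT : set (g_sigma_algebraType (@open 'M[R]_d))) g ->
  ess_bounded (g \o X n) ->
  Ex (fun w => f w * g (X n w)) = Ex f * Ex (g \o X n).
Proof.
move=> [mf bf] mg bg.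
have mgX : measurable_fun setT (g \o X n).
  move=> _ B mB; rewrite setTI comp_preimage; apply: rX.
  by have := mg measurableT B mB; rewrite setTI.
have mf' := adapted_measurable mf.
(* The identity, seen as a map into Omega with the sigma-algebra of the first [n] samples, is the
   random variable of which an adapted [f] is a measurable function. *)
apply: (@indep_Rintegral_mul _ _ _ P _ _ (g_sigma_algebraType (past n))
  (g_sigma_algebraType (@open 'M[R]_d)) id (X n) f g) => //.
- move=> _ A mA; rewrite setTI.
  exact: (sub_sigma_algebra_measurable (@past_measurable n)).
- by move=> _ B mB; rewrite setTI; exact: rX.
- move=> A B sA mB; apply: (indep_event_generated (@setI_closed_past n)) => //.
  + exact: past_measurable.
  + exact: rX.
  + by move=> E pE; exact: indep_past.
- exact: integrable_ess_bounded.
- exact: integrable_ess_bounded.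
- by apply: integrable_ess_bounded; [exact: measurable_funM|exact: ess_boundedM].
Qed.

End bounded_adapted.

(** * Euclidean norms *)

Section euclidean.
Context {R : realType} (d : nat).
Implicit Types (x y z : 'cV[R]_d) (M : 'M[R]_d).

Lemma dotvE x y : dotv x y = \sum_i x i 0 * y i 0.
Proof. by rewrite /dotv mxE; apply: eq_bigr => i _; rewrite mxE. Qed.

Lemma dotvC x y : dotv x y = dotv y x.
Proof. by rewrite !dotvE; apply: eq_bigr => i _; rewrite mulrC. Qed.

Lemma dotvDr x y z : dotv x (y + z) = dotv x y + dotv x z.
Proof. by rewrite /dotv mulmxDr mxE. Qed.

Lemma dotvZr a x y : dotv x (a *: y) = a * dotv x y.
Proof. by rewrite /dotv -scalemxAr mxE. Qed.

Lemma dotvBr x y z : dotv x (y - z) = dotv x y - dotv x z.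
Proof. by rewrite dotvDr -scaleN1r dotvZr mulN1r. Qed.

Lemma dotvDl x y z : dotv (x + y) z = dotv x z + dotv y z.
Proof. by rewrite ![dotv _ z]dotvC dotvDr. Qed.

Lemma dotvZl a x y : dotv (a *: x) y = a * dotv x y.
Proof. by rewrite ![dotv _ y]dotvC dotvZr. Qed.

Lemma dotvBl x y z : dotv (x - y) z = dotv x z - dotv y z.
Proof. by rewrite ![dotv _ z]dotvC dotvBr. Qed.

Lemma dotv0r x : dotv x 0 = 0.
Proof. by rewrite /dotv mulmx0 mxE. Qed.

Lemma dotv_mulmx_sym M x y : M^T = M -> dotv x (M *m y) = dotv (M *m x) y.
Proof. by move=> sM; rewrite /dotv trmx_mul sM mulmxA. Qed.

Lemma dotv_ge0 x : 0 <= dotv x x.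
Proof. by rewrite dotvE sumr_ge0// => i _; rewrite -expr2 sqr_ge0. Qed.

Lemma norm2_sqr x : norm2 x ^+ 2 = dotv x x.
Proof. by rewrite sqr_sqrtr// dotv_ge0. Qed.

Lemma norm2_ge0 x : 0 <= norm2 x. Proof. exact: sqrtr_ge0. Qed.

Lemma norm2Z a x : norm2 (a *: x) = `|a| * norm2 x.
Proof.
by rewrite /norm2 dotvZl dotvZr mulrA -expr2 sqrtrM ?sqr_ge0// sqrtr_sqr.
Qed.

Lemma dotv_eq0 x : (dotv x x == 0) = (x == 0).
Proof.
apply/eqP/eqP => [|->]; last by rewrite dotv0r.
rewrite dotvE => /eqP; rewrite psumr_eq0 => [/allP H|i _]; last first.
  by rewrite -expr2 sqr_ge0.
apply/colP => i; rewrite mxE; apply/eqP.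
by have := H i; rewrite mem_index_enum /= -expr2 sqrf_eq0; apply.
Qed.

Lemma norm2_eq0 x : (norm2 x == 0) = (x == 0).
Proof. by rewrite -dotv_eq0 -norm2_sqr sqrf_eq0. Qed.

Lemma entry_le_norm2 x i : `|x i 0| <= norm2 x.
Proof.
rewrite -sqrtr_sqr ler_sqrt ?dotv_ge0// dotvE (bigD1 i)//= expr2 lerDl.
by apply: sumr_ge0 => j _; rewrite -expr2 sqr_ge0.
Qed.

(** [sup] has its meaning only on a nonempty bounded set. Entries of a vector in the unit ball are
    at most 1 in absolute value, so absolute row sums give a crude bound. *)
Lemma spectral_norm_has_sup M :
  has_sup [set norm2 (M *m x) | x in [set x : 'cV[R]_d | norm2 x <= 1]].
Proof.
split.
  by exists (norm2 (M *m 0)), 0 => //=; rewrite /norm2 dotv0r sqrtr0.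
exists (Num.sqrt (\sum_i (\sum_j `|M i j|) ^+ 2)) => _ [x /= x1 <-].
rewrite ler_sqrt; last by rewrite sumr_ge0// => i _; rewrite sqr_ge0.
rewrite dotvE ler_sum// => i _; rewrite -expr2 -real_normK ?num_real//.
have xj j : `|x j 0| <= 1 by exact: le_trans (entry_le_norm2 x j) x1.
rewrite ler_sqr ?nnegrE ?sumr_ge0// mxE (le_trans (ler_norm_sum _ _ _))//.
by rewrite ler_sum// => j _; rewrite normrM ler_piMr.
Qed.

Lemma norm2_mulmx_le M x : norm2 (M *m x) <= spectral_norm M * norm2 x.
Proof.
have [->|x0] := eqVneq x 0.
  by rewrite mulmx0 /norm2 dotv0r sqrtr0 mulr0.
have nx : 0 < norm2 x by rewrite lt_neqAle norm2_ge0 eq_sym norm2_eq0 x0.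
rewrite -ler_pdivrMr//.
have -> : norm2 (M *m x) / norm2 x = norm2 (M *m ((norm2 x)^-1 *: x)).
  by rewrite -scalemxAr norm2Z ger0_norm ?invr_ge0 ?norm2_ge0// mulrC.
apply: sup_upper_bound; first exact: spectral_norm_has_sup.
exists ((norm2 x)^-1 *: x) => //=.
by rewrite norm2Z ger0_norm ?invr_ge0 ?norm2_ge0// mulVf// gt_eqF.
Qed.

Lemma entry_le_spectral_norm M i j : `|M i j| <= spectral_norm M.
Proof.
pose e : 'cV[R]_d := delta_mx j 0.
have ne : norm2 e = 1.
  rewrite /norm2 dotvE (bigD1 j)//= big1 ?addr0 => [|k kj].
    by rewrite !mxE !eqxx mulr1 sqrtr1.
  by rewrite !mxE (negbTE kj) mul0r.
have := norm2_mulmx_le M e; rewrite ne mulr1; apply: le_trans.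
apply: le_trans (entry_le_norm2 (M *m e) i).
by rewrite /e -colE mxE.
Qed.

Section orthonormal.
Variable u : 'I_d -> 'cV[R]_d.
Hypothesis ou : orthonormal_family u.

(** Parseval. The family has as many vectors as the dimension, so the matrix U of its columns is
    square and U^T U = 1 implies U U^T = 1. *)
Lemma dotv_orthonormal x y : dotv x y = \sum_i dotv (u i) x * dotv (u i) y.
Proof.
pose U : 'M[R]_d := \matrix_(i, j) u j i 0.
have UU : U^T *m U = 1%:M.
  apply/matrixP => i j; rewrite !mxE -ou dotvE.
  by apply: eq_bigr => k _; rewrite !mxE.
have UU' : U *m U^T = 1%:M by rewrite mulmx1C.
have Ux z i : (U^T *m z) i 0 = dotv (u i) z.
  by rewrite dotvE mxE; apply: eq_bigr => k _; rewrite !mxE.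
rewrite {1}/dotv -[y in LHS]mul1mx -UU' -mulmxA mulmxA -[x^T *m U]trmxK trmx_mul trmxK.
by rewrite mxE; apply: eq_bigr => i _; rewrite mxE !Ux.
Qed.

End orthonormal.
End euclidean.

(** * Scaled Chebyshev polynomials *)

Section chebyshev.
Context {R : realType}.
Implicit Types (beta x : R) (t : nat).

(* [cheb beta x t] is beta^(t/2) U_t(x / (2 sqrt beta)), U_t the Chebyshev
   polynomial of the second kind. *)
Fixpoint cheb_pair beta x t : R * R :=
  if t is t'.+1 then
    let p := cheb_pair beta x t' in (x * p.1 - beta * p.2, p.1)
  else (1, 0).

Definition cheb beta x t : R := (cheb_pair beta x t).1.

Lemma cheb0 beta x : cheb beta x 0 = 1. Proof. by []. Qed.

Lemma cheb1 beta x : cheb beta x 1 = x.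
Proof. by rewrite /cheb /= mulr1 mulr0 subr0. Qed.

Lemma chebSS beta x t :
  cheb beta x t.+2 = x * cheb beta x t.+1 - beta * cheb beta x t.
Proof. by []. Qed.

Lemma cheb_duhamel beta x (y e : nat -> R) :
  y 1%N = x * y 0%N + e 0%N ->
  (forall t, y t.+2 = x * y t.+1 - beta * y t + e t.+1) ->
  forall t, y t = cheb beta x t * y 0%N + \sum_(j < t) cheb beta x (t.-1 - j) * e j.
Proof.
move=> y1 ySS t.
suff [] : y t = cheb beta x t * y 0%N + \sum_(j < t) cheb beta x (t.-1 - j) * e j /\
  y t.+1 = cheb beta x t.+1 * y 0%N + \sum_(j < t.+1) cheb beta x (t - j) * e j by [].
elim: t => [|t [IH0 IH1]].
  rewrite big_ord0 cheb0 addr0 mul1r; split => //.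
  by rewrite big_ord1 cheb1 /cheb/= mul1r y1.
split => //; rewrite ySS IH1 IH0 chebSS [in RHS]big_ord_recr/= subnn cheb0 mul1r.
rewrite [in RHS]big_ord_recr/= [in LHS]big_ord_recr/=.
rewrite subSn// !subnn cheb1 cheb0.
have -> : \sum_(i < t) cheb beta x (t.+1 - i) * e i =
  x * \sum_(i < t) cheb beta x (t - i) * e i -
  beta * \sum_(i < t) cheb beta x (t.-1 - i) * e i.
  rewrite !mulr_sumr -sumrB; apply: eq_bigr => i _.
  have -> : (t.+1 - i = (t.-1 - i).+2)%N by have := ltn_ord i; lia.
  have -> : (t - i = (t.-1 - i).+1)%N by have := ltn_ord i; lia.
  by rewrite chebSS mulrBl !mulrA.
ring.
Qed.

Lemma geometric_duhamel (z : R) (y e : nat -> R) :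
  (forall t, y t.+1 = z * y t + e t) ->
  forall t, y t = z ^+ t * y 0%N + \sum_(j < t) z ^+ (t.-1 - j) * e j.
Proof.
move=> yS; elim=> [|t IH]; first by rewrite big_ord0 expr0 mul1r addr0.
rewrite yS IH big_ord_recr/= subnn expr0 mul1r mulrDr mulrA -exprS -addrA.
congr (_ + (_ + _)); rewrite mulr_sumr; apply: eq_bigr => i _.
rewrite mulrA -exprS; congr (_ ^+ _ * _); have := ltn_ord i; lia.
Qed.

Lemma cheb_small (b x : R) t : 0 <= x <= 2 * b ->
  `|cheb (b ^+ 2) x t| <= t.+1%:R * b ^+ t.
Proof.
move=> /andP[x0 xb]; have b0 : 0 <= b by lra.
pose h := x / 2; have xE : x = h + h by rewrite /h; field.
(* Pell's identity T_{t+1}(y)^2 + (1 - y^2) U_t(y)^2 = 1 at y = h / b, multiplied by b^(2t+2): the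
   first square is that of b^(t+1) T_{t+1}(y). Stated this way it needs no division by [b]. *)
have inv : forall t, (cheb (b ^+ 2) x t.+1 - h * cheb (b ^+ 2) x t) ^+ 2 +
   (b ^+ 2 - h ^+ 2) * cheb (b ^+ 2) x t ^+ 2 = (b ^+ t.+1) ^+ 2.
  elim=> [|k IH]; first by rewrite cheb1 cheb0 xE; ring.
  have -> : (b ^+ k.+2) ^+ 2 = b ^+ 2 * (b ^+ k.+1) ^+ 2 by rewrite -exprMn -exprS.
  rewrite -IH chebSS; set p := cheb _ _ k.+1.
  by set p' := cheb _ _ k; rewrite {1}xE; ring.
have step k : `|cheb (b ^+ 2) x k.+1 - h * cheb (b ^+ 2) x k| <= b ^+ k.+1.
  rewrite -ler_sqr ?nnegrE ?exprn_ge0// real_normK ?num_real// -inv lerDl.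
  by rewrite mulr_ge0 ?sqr_ge0//; nra.
elim: t => [|t IH]; first by rewrite cheb0 normr1 mul1r expr0.
rewrite -[cheb _ _ t.+1](subrK (h * cheb (b ^+ 2) x t)).
rewrite (le_trans (ler_normD _ _))//.
have hp : `|h * cheb (b ^+ 2) x t| <= b * (t.+1%:R * b ^+ t).
  by rewrite normrM ler_pM// ger0_norm; lra.
apply: le_trans (lerD (step t) hp) _.
by rewrite -[t.+2%:R]natr1 mulrDl mul1r [b * _]mulrCA -exprS addrC.
Qed.

Section dominant.
Variables (lam b : R).
Hypotheses (b0 : 0 <= b) (blam : 2 * b < lam).

Let beta := b ^+ 2.
(** [zplus] and [zminus] are the roots of z^2 - lam z + b^2, the characteristic polynomial of the
    recurrence along u_1. Their difference [cheb_gap] is the square root in the denominator of the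
    epoch length. *)
Definition cheb_gap := Num.sqrt (lam ^+ 2 - 4 * b ^+ 2).
Definition zplus := (lam + cheb_gap) / 2.
Definition zminus := (lam - cheb_gap) / 2.
Let D := cheb_gap.
Let q := cheb beta lam.

Let gap_gt0 : 0 < lam ^+ 2 - 4 * b ^+ 2.
Proof.
have -> : lam ^+ 2 - 4 * b ^+ 2 = (lam - 2 * b) * (lam + 2 * b) by ring.
by have := b0; have := blam => ? ?; apply: mulr_gt0; lra.
Qed.

Lemma cheb_gap_sqr : D ^+ 2 = lam ^+ 2 - 4 * b ^+ 2.
Proof. by rewrite sqr_sqrtr// ltW. Qed.

Lemma cheb_gap_gt0 : 0 < D.
Proof. by rewrite sqrtr_gt0. Qed.

Lemma zplus_add_zminus : zplus + zminus = lam.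
Proof. by rewrite /zplus /zminus; field. Qed.

Lemma zplus_sub_zminus : zplus - zminus = D.
Proof. by rewrite /zplus /zminus /D; field. Qed.

Lemma zplus_mul_zminus : zplus * zminus = b ^+ 2.
Proof.
have := cheb_gap_sqr; rewrite /zplus /zminus -/D => H.
have -> : (lam + D) / 2 * ((lam - D) / 2) = (lam ^+ 2 - D ^+ 2) / 4 by field.
by rewrite H; field.
Qed.

Lemma zminus_ge0 : 0 <= zminus.
Proof.
have lam0 : 0 <= lam by have := b0; have := blam; lra.
apply: divr_ge0 => //; rewrite subr_ge0 -ler_sqr ?nnegrE ?(ltW cheb_gap_gt0)//.
by rewrite cheb_gap_sqr gerBl mulr_ge0 ?sqr_ge0.
Qed.

Lemma zminus_lt_zplus : zminus < zplus.
Proof. by have := cheb_gap_gt0; rewrite -zplus_sub_zminus; lra. Qed.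

Lemma zplus_gt0 : 0 < zplus.
Proof. exact: le_lt_trans zminus_ge0 zminus_lt_zplus. Qed.

(** Binet's formula for the recurrence. *)
Lemma cheb_gapE t : q t * D = zplus ^+ t.+1 - zminus ^+ t.+1.
Proof.
suff [] : q t * D = zplus ^+ t.+1 - zminus ^+ t.+1 /\
  q t.+1 * D = zplus ^+ t.+2 - zminus ^+ t.+2 by [].
elim: t => [|t [IH0 IH1]].
  rewrite /q cheb0 cheb1 mul1r !expr1 zplus_sub_zminus; split => //.
  by rewrite -zplus_sub_zminus -[lam]zplus_add_zminus; ring.
split => //; rewrite /q chebSS -/q mulrBl -!mulrA IH0 IH1.
rewrite [b * (b * _)]mulrA -expr2 -zplus_mul_zminus.
rewrite -[X in X * (_ - _)]zplus_add_zminus !exprS; ring.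
Qed.

Lemma cheb_le_zplus t : q t * D <= zplus ^+ t.+1.
Proof. by rewrite cheb_gapE gerBl exprn_ge0// zminus_ge0. Qed.

Lemma cheb_gt0 t : 0 < q t.
Proof.
rewrite -(pmulr_lgt0 _ cheb_gap_gt0) cheb_gapE subr_gt0.
by rewrite ltr_pXn2r ?nnegrE ?zminus_ge0 ?zminus_lt_zplus// ltW ?zplus_gt0.
Qed.

(** In Binet form this is (P - M)(P' - M') <= P P' - M M', valid for 0 <= M <= P and 0 <= M' <= P'.
    It compares two consecutive propagations, separated by an injection of noise, with a single
    one. *)
Lemma cheb_submul s t : q s * q t * D <= q (s + t).+1.
Proof.
rewrite -(ler_pM2r cheb_gap_gt0).
have -> : q s * q t * D * D = (q s * D) * (q t * D) by ring.
rewrite !cheb_gapE; have -> : (s + t).+2 = (s.+1 + t.+1)%N by rewrite addSn addnS.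
rewrite !exprD.
have m0 := zminus_ge0; have p0 := ltW zplus_gt0; have mp := ltW zminus_lt_zplus.
have h n : zminus ^+ n <= zplus ^+ n by rewrite lerXn2r ?nnegrE.
have hs := h s.+1; have ht := h t.+1.
have hm := exprn_ge0 s.+1 m0; have hm' := exprn_ge0 t.+1 m0.
nra.
Qed.

(** The tangent line of U_t at 1, with U_t(1) = t + 1 and U_t'(1) = ((t+1)^3 - (t+1)) / 3, lies
    below U_t on [1, oo). Scaling by 2b keeps the case [b = 0] meaningful. The induction carries the
    increment q_{t+1} - b q_t along, since the recurrence has order two. *)
Lemma cheb_lower t :
  b ^+ t * (2 * b * t.+1%:R + (lam - 2 * b) * (t.+1%:R ^+ 3 - t.+1%:R) / 3)
  <= 2 * b * q t.
Proof.
have h0 := b0; have h1 := blam; pose G n : R := 2 * b * n%:R + (lam - 2 * b) * (n%:R ^+ 3 - n%:R) / 3.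
suff [] : b ^+ t * G t.+1 <= 2 * b * q t /\
  b ^+ t.+1 * (G t.+2 - G t.+1) <= 2 * b * (q t.+1 - b * q t) by [].
elim: t => [|t [IH0 IH1]].
  rewrite /q cheb0 cheb1 /G expr0 expr1; split; first lra.
  have -> : 2%:R ^+ 3 = 8 :> R by ring.
  have -> : 1%:R ^+ 3 = 1 :> R by ring.
  nra.
split.
  by have := ler_wpM2l b0 IH0; rewrite mulrA -exprS; lra.
rewrite /q chebSS -/q.
have -> : G t.+3 - G t.+2 = (G t.+2 - G t.+1) + 2 * (lam - 2 * b) * t.+2%:R.
  by rewrite /G -[t.+3%:R]natr1 -[t.+2%:R]natr1; field.
have h5 := ler_wpM2l b0 IH1; rewrite mulrA -exprS in h5.
have h2 : b ^+ t.+1 * G t.+2 <= 2 * b * q t.+1.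
  have := ler_wpM2l b0 IH0; rewrite mulrA -exprS; lra.
have h3 : b ^+ t.+2 * (2 * t.+2%:R) <= 2 * b * q t.+1.
  apply: le_trans h2; rewrite exprSr -mulrA ler_wpM2l ?exprn_ge0// /G.
  rewrite [leLHS]mulrA [b * 2]mulrC lerDl divr_ge0// mulr_ge0//; first lra.
  rewrite subr_ge0 exprS ler_peMr ?ler0n//.
  by rewrite -natrX ler1n expn_gt0.
have h4 : b ^+ t.+2 * (2 * t.+2%:R) * (lam - 2 * b) <= 2 * b * q t.+1 * (lam - 2 * b).
  by rewrite ler_wpM2r//; lra.
rewrite /beta; lra.
Qed.

End dominant.
End chebyshev.

(** * Damping over one epoch and accumulation of the noise *)

Section noise_growth.
Context {R : realType}.
Variables (lam b : R).
Hypotheses (b0 : 0 <= b) (blam : 2 * b < lam).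
Let D := cheb_gap lam b.
Let q := cheb (b ^+ 2) lam.

(** Write lam = 2b(1 + k). The damped modes are at most (T+1) b^T by [cheb_small], while
    [cheb_lower] gives q_T >= (T+1) b^T (1 + k(T^2 + 2T)/3). The epoch length forces k(T^2 + 2T) >=
    0.91, so the ratio is at most 1/1.3, whose square is below 593/1000. *)
Lemma cheb_ratio (T : nat) (L x : R) : (0 < T)%N -> 27 / 10 <= L ->
  b * L <= T%:R * D -> 0 <= x <= 2 * b ->
  cheb (b ^+ 2) x T ^+ 2 <= 593 / 1000 * q T ^+ 2.
Proof.
move=> T0 L27 bL x01.
have px := cheb_small T x01; have q0 : 0 < q T := cheb_gt0 b0 blam T.
rewrite -[leLHS]real_normK ?num_real//.
suff : T.+1%:R * b ^+ T * (13 / 10) <= q T.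
  set p := `|_| in px *; have p0 : 0 <= p by exact: normr_ge0.
  move: px; set y := _ * b ^+ T => py yq.
  have pq : p * (13 / 10) <= q T by nra.
  have : (p * (13 / 10)) ^+ 2 <= q T ^+ 2 by rewrite ler_sqr ?nnegrE ?(ltW q0) ?mulr_ge0//; lra.
  have ? := sqr_ge0 p; rewrite exprMn; lra.
have [b00|bn0] := eqVneq b 0.
  by rewrite b00 expr0n eqn0Ngt T0 mulr0 mul0r ltW.
have bp : 0 < b by rewrite lt_neqAle eq_sym bn0.
have := cheb_lower b0 blam T; rewrite -/q.
have T1 : 1 <= T%:R :> R by rewrite ler1n.
have D2 : D ^+ 2 = lam ^+ 2 - 4 * b ^+ 2 := cheb_gap_sqr b0 blam.
pose k := (lam - 2 * b) / (2 * b).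
have k0 : 0 < k by rewrite divr_gt0//; move: blam => ?; lra.
have lamE : lam = 2 * b * (1 + k) by rewrite /k; field.
set t : R := T%:R in T1 bL *.
have D2k : D ^+ 2 = b ^+ 2 * (4 * (2 * k + k ^+ 2)) by rewrite D2 lamE; ring.
(* Squaring b L <= T D gives t^2 (2k + k^2) >= L^2 / 4 > 1.82. Either k t^2 alone reaches 0.91, or k
   t < 0.91, and then (k t)^2 <= 0.91 k t is absorbed by the term 2 k t. *)
have kt : 91 / 100 <= k * (t ^+ 2 + 2 * t).
  have : (b * L) ^+ 2 <= (t * D) ^+ 2.
    have D0 : 0 < D := cheb_gap_gt0 b0 blam.
    by rewrite ler_sqr ?nnegrE// mulr_ge0//; lra.
  have -> : (b * L) ^+ 2 = b ^+ 2 * L ^+ 2 by ring.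
  have -> : (t * D) ^+ 2 = b ^+ 2 * (t ^+ 2 * (4 * (2 * k + k ^+ 2))).
    by rewrite exprMn D2k; ring.
  rewrite ler_pM2l ?exprn_gt0// => H.
  have L2 : 729 / 100 <= L ^+ 2 by rewrite expr2; nra.
  have [h|h] := leP (91 / 100) (k * t ^+ 2).
    have ? : 0 <= k * t by rewrite mulr_ge0 ?ltW//; lra.
    lra.
  have h1 : k * t <= k * t ^+ 2 by rewrite ler_pM2l// expr2; nra.
  have h2 : (k * t) ^+ 2 <= 91 / 100 * (k * t).
    have ? : 0 <= k * t by rewrite mulr_ge0 ?ltW//; lra.
    rewrite expr2; nra.
  move: h2; rewrite exprMn => h2; nra.
rewrite -[T.+1%:R]natr1 -/t => H.
have bT : 0 <= b ^+ T by rewrite exprn_ge0.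
have lamb : lam - 2 * b = 2 * b * k by rewrite lamE; ring.
have E : 2 * b * (t + 1) + (lam - 2 * b) * ((t + 1) ^+ 3 - (t + 1)) / 3 =
  2 * b * ((t + 1) * (1 + k * (t ^+ 2 + 2 * t) / 3)) by rewrite lamb; field.
move: H; rewrite E mulrCA ler_pM2l; last by rewrite mulr_gt0.
apply: le_trans; rewrite mulrAC mulrC ler_wpM2l// ler_wpM2l//; lra.
Qed.

Variables (V : nat -> R) (eta G : R).
Hypothesis V0 : V 0%N = 0.
Hypotheses (eta0 : 0 <= eta) (G0 : 0 <= G).
Hypothesis VS : forall j, V j.+1 <=
  eta * (G * q j.+1 ^+ 2 + \sum_(i < j.+1) q (j - i) ^+ 2 * V i).
Let h := eta / D ^+ 2.

Let D2_gt0 : 0 < D ^+ 2. Proof. by rewrite exprn_gt0 ?cheb_gap_gt0. Qed.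

(** With V_0 = 0 and the growth bound inserted, the sum is dominated by the geometric series of h (1
    + h)^j, which telescopes. The growth bound is assumed only below [t], so that its own induction
    can use this lemma. *)
Let weighted_noise_aux (c : nat -> R) (W : R) (t : nat) :
  (forall j, (j < t)%N -> V j.+1 <= eta * G * q j.+1 ^+ 2 * (1 + h) ^+ j) ->
  (forall j, 0 <= c j) ->
  (forall j, (j < t)%N -> c j.+1 * q j.+1 ^+ 2 * D ^+ 2 <= W) ->
  \sum_(j < t.+1) c j * V j <= W * G * ((1 + h) ^+ t - 1).
Proof.
move=> HV c0 cW; rewrite big_ord_recl V0 mulr0 add0r.
have h0 : 0 <= h by rewrite divr_ge0// ltW.
have -> : W * G * ((1 + h) ^+ t - 1) = \sum_(j < t) W * G * (h * (1 + h) ^+ j).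
  rewrite -mulr_sumr -mulr_sumr; congr (_ * _).
  by rewrite subrX1 addrAC subrr add0r.
apply: ler_sum => j _; rewrite lift0.
apply: (@le_trans _ _ (c j.+1 * (eta * G * q j.+1 ^+ 2 * (1 + h) ^+ j))).
  by rewrite ler_wpM2l// HV.
have -> : c j.+1 * (eta * G * q j.+1 ^+ 2 * (1 + h) ^+ j) =
  (c j.+1 * q j.+1 ^+ 2 * D ^+ 2) * (G * (h * (1 + h) ^+ j)).
  by rewrite /h; field; rewrite gt_eqF// cheb_gap_gt0.
rewrite -[leRHS]mulrA ler_wpM2r ?cW//.
by rewrite mulr_ge0// mulr_ge0// exprn_ge0//; lra.
Qed.

Lemma cheb_weight_le i j : q i ^+ 2 * q j ^+ 2 * D ^+ 2 <= q (i + j).+1 ^+ 2.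
Proof.
have qn n : 0 < q n := cheb_gt0 b0 blam n.
have D0 : 0 < D := cheb_gap_gt0 b0 blam.
rewrite -!exprMn ler_sqr ?nnegrE; [exact: cheb_submul| |exact: ltW].
by rewrite mulr_ge0 ?mulr_ge0// ltW.
Qed.

(** Discrete Gronwall. By [cheb_submul] the convolution kernel satisfies q_{j-i-1}^2 q_{i+1}^2 <=
    q_{j+1}^2 / D^2, so relative to q^2 every earlier noise term is fed back with the factor h = eta
    / D^2. *)
Lemma noise_growth j : V j.+1 <= eta * G * q j.+1 ^+ 2 * (1 + h) ^+ j.
Proof.
elim/ltn_ind: j => j IH; apply: le_trans (VS j) _.
have -> : eta * G * q j.+1 ^+ 2 * (1 + h) ^+ j =
  eta * (G * q j.+1 ^+ 2 + q j.+1 ^+ 2 * G * ((1 + h) ^+ j - 1)) by ring.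
rewrite ler_wpM2l// lerD2l.
apply: (weighted_noise_aux (c := fun i => q (j - i) ^+ 2)) => //.
  by move=> i; exact: sqr_ge0.
move=> i ij; have := cheb_weight_le (j - i.+1) i.+1.
by rewrite subnK.
Qed.

Lemma weighted_noise (c : nat -> R) (W : R) (t : nat) :
  (forall j, 0 <= c j) ->
  (forall j, (j < t)%N -> c j * q j ^+ 2 * D ^+ 2 <= W) ->
  \sum_(j < t) c j * V j <= W * G * ((1 + h) ^+ t.-1 - 1).
Proof.
case: t => [|t] c0 cW; first by rewrite big_ord0 subrr mulr0.
by apply: weighted_noise_aux => // j jt; [exact: noise_growth|exact: cW].
Qed.

End noise_growth.

(** * Rational bounds for logarithms *)

Section numeric.
Context {R : realType}.

(** Equivalently exp(-27/40) >= 1/2: exp(-27/640) >= 613/640, and four squarings, each rounded down,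
    leave more than 1/2. *)
Lemma ln2_ge : 27 / 40 <= ln 2 :> R.
Proof.
have e16 : 1 / 2 <= expR (- (27 / 40)) :> R.
  have -> : - (27 / 40) = 16%:R * (- (27 / 640)) :> R by field.
  rewrite expRM_natl.
  have sq (x c e : R) : 0 <= c -> c <= x -> e <= c * c -> e <= x ^+ 2.
    by move=> c0 cx ec; rewrite expr2 (le_trans ec)// ler_pM.
  set x := expR _; have h0 : 613 / 640 <= x.
    by have := @expR_ge1Dx R (- (27 / 640)); rewrite -/x; lra.
  have -> : x ^+ 16 = (((x ^+ 2) ^+ 2) ^+ 2) ^+ 2 by rewrite -!exprM.
  have h1 : 9174 / 10000 <= x ^+ 2 by apply: sq h0 _; lra.
  have h2 : 8416 / 10000 <= (x ^+ 2) ^+ 2 by apply: sq h1 _; lra.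
  have h3 : 708 / 1000 <= ((x ^+ 2) ^+ 2) ^+ 2 by apply: sq h2 _; lra.
  by apply: sq h3 _; lra.
rewrite -ler_expR lnK ?posrE// -[leLHS]invrK -expRN.
rewrite -[leRHS]invrK lef_pV2 ?posrE ?expR_gt0 ?invr_gt0//; lra.
Qed.

Lemma ln16_le (x : R) : 0 < x <= 1 / 16 -> 27 / 10 <= ln (1 / x).
Proof.
move=> /andP[x0 x16]; have := ln2_ge => h.
have h16 : ln (2 ^+ 4) = 4 * ln 2 :> R by rewrite lnXn// mulr_natl.
apply: (@le_trans _ _ (ln (2 ^+ 4))); first by rewrite h16; lra.
rewrite ler_ln ?posrE ?exprn_gt0 ?divr_gt0// ler_pdivlMr//.
have -> : 2 ^+ 4 = 16 :> R by ring.
lra.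
Qed.

End numeric.

(** * Moments of a batch *)

Section adapted_matrices.
Context {R : realType} {dT : measure_display} {Omega : measurableType dT}.
Variables (P : probability Omega R) (d : nat) (X : nat -> Omega -> 'M[R]_d).
Local Notation bdd := (bdd_adapted P X).

Definition bdd_mx n p q (M : Omega -> 'M[R]_(p, q)) :=
  forall i j, bdd n (fun w => M w i j).

Lemma bdd_mx_cst n p q (M : 'M[R]_(p, q)) : bdd_mx n (fun=> M).
Proof. by move=> i j; exact: bdd_adapted_cst. Qed.

Lemma bdd_mx_le m n p q (M : Omega -> 'M[R]_(p, q)) :
  (m <= n)%N -> bdd_mx m M -> bdd_mx n M.
Proof. by move=> mn bM i j; apply: bdd_adapted_le mn _. Qed.

Lemma bdd_mxD n p q (M N : Omega -> 'M[R]_(p, q)) :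
  bdd_mx n M -> bdd_mx n N -> bdd_mx n (fun w => M w + N w).
Proof.
by move=> bM bN i j; under eq_fun do rewrite mxE; exact: bdd_adaptedD.
Qed.

Lemma bdd_mxZ n p q (f : Omega -> R) (M : Omega -> 'M[R]_(p, q)) :
  bdd n f -> bdd_mx n M -> bdd_mx n (fun w => f w *: M w).
Proof.
by move=> bf bM i j; under eq_fun do rewrite mxE; exact: bdd_adaptedM.
Qed.

Lemma bdd_mxB n p q (M N : Omega -> 'M[R]_(p, q)) :
  bdd_mx n M -> bdd_mx n N -> bdd_mx n (fun w => M w - N w).
Proof.
move=> bM bN i j; under eq_fun do rewrite !mxE; exact: bdd_adaptedB.
Qed.

Lemma bdd_mxM n p q r (M : Omega -> 'M[R]_(p, q)) (N : Omega -> 'M[R]_(q, r)) :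
  bdd_mx n M -> bdd_mx n N -> bdd_mx n (fun w => M w *m N w).
Proof.
move=> bM bN i j; under eq_fun do rewrite mxE.
by apply: bdd_adapted_sum => k _; exact: bdd_adaptedM.
Qed.

Lemma bdd_mx_sum n p q (I : Type) (r : seq I) (F : I -> Omega -> 'M[R]_(p, q)) :
  (forall i, bdd_mx n (F i)) -> bdd_mx n (fun w => \sum_(i <- r) F i w).
Proof.
move=> bF i j; under eq_fun do rewrite summxE.
by apply: bdd_adapted_sum => k _; exact: bF.
Qed.

Lemma bdd_dotv n p (x y : Omega -> 'cV[R]_p) :
  bdd_mx n x -> bdd_mx n y -> bdd n (fun w => dotv (x w) (y w)).
Proof.
move=> bx By; under eq_fun do rewrite dotvE.
by apply: bdd_adapted_sum => k _; exact: bdd_adaptedM.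
Qed.

End adapted_matrices.

(* Spares a proof that the spectral norm is measurable. *)
Lemma le_integral_nonmeasurable {d} {T : measurableType d} {R : realType}
    (mu : {measure set T -> \bar R}) (f g : T -> R) :
  (forall x, 0 <= f x) -> (forall x, f x <= g x) ->
  (\int[mu]_x (f x)%:E <= \int[mu]_x (g x)%:E)%E.
Proof.
move=> f0 fg; rewrite !ge0_integralTE => [|x|x]; rewrite ?lee_fin//; last first.
  exact: le_trans (f0 x) (fg x).
apply: ge_ereal_sup => _ [h hf <-]; apply: ereal_sup_ubound; exists h => // x.
by rewrite (le_trans (hf x))// lee_fin.
Qed.

Section batch_moments.
Context {R : realType} {dT : measure_display} {Omega : measurableType dT}.
Variables (P : probability Omega R) (d : nat) (X : nat -> Omega -> 'M[R]_d).
Variables (A : 'M[R]_d) (r sigma : R).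
Hypothesis iidX : iid P X.
Hypothesis meanX : forall k, mx_mean P (X k) A.
Hypothesis boundX : forall k, {ae P, forall w, spectral_norm (X k w) <= r}.
Hypothesis varX : forall k,
  ('E_P[fun w => (spectral_norm (X k w - A) ^+ 2)%R] = (sigma ^+ 2)%:E)%E.

Local Notation bdd := (bdd_adapted P X).
Local Notation E := (Ex P).

Let rX n : random_mx (X n). Proof. by have [] := iidX. Qed.
Let indX : mutually_independent P X. Proof. by have [] := iidX. Qed.

Let ess_bounded_entry n i j : ess_bounded P (fun w => X n w i j).
Proof.
exists r; apply: filterS (boundX n) => w; apply: le_trans.
exact: entry_le_spectral_norm.
Qed.

Let measurable_entry i j (c : R) :
  measurable_fun (setT : set (g_sigma_algebraType (@open 'M[R]_d)))
    (fun M => M i j - c).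
Proof.
apply: measurable_funB => //.
by move=> _ B mB; rewrite setTI; exact: mx_borel_entry.
Qed.

Lemma bdd_sample m n : (m < n)%N -> bdd_mx P X n (X m).
Proof.
move=> mn i j; split; last exact: ess_bounded_entry.
move=> _ B mB; rewrite setTI; apply: sub_sigma_algebra.
exists (fun k => if k == m then (fun M : 'M[R]_d => M i j) @^-1` B else setT).
split; first by move=> k; case: ifP => _; [exact: mx_borel_entry|exact: mx_borelT].
apply/seteqP; split => w /=.
  by move=> Bw k _; case: ifP => // /eqP ->.
by move/(_ m); rewrite eqxx; apply; rewrite /= mem_iota.
Qed.

Let D n w := X n w - A.

Let Ess n i j : ess_bounded P (fun w => D n w i j).
Proof.
rewrite /D; under eq_fun do rewrite !mxE.
by apply: ess_boundedD => //; exact: ess_bounded_cst.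
Qed.

Lemma bdd_deviation m n : (m < n)%N -> bdd_mx P X n (D m).
Proof.
by move=> mn; apply: bdd_mxB; [exact: bdd_sample|exact: bdd_mx_cst].
Qed.

Let Ex_entry n i j : E (fun w => D n w i j) = 0.
Proof.
have bX : bdd n.+1 (fun w => X n w i j) by exact: bdd_sample.
rewrite /D; under eq_fun do rewrite !mxE.
rewrite (ExD rX bX (bdd_adapted_cst _ _ _ _)) Ex_cst /Ex /Rintegral.
by have := meanX n i j; rewrite unlock => ->; rewrite subrr.
Qed.

Lemma Ex_deviation n f i j : bdd n f -> E (fun w => f w * D n w i j) = 0.
Proof.
move=> bf; transitivity (E (fun w => f w * (X n w i j - A i j))).
  by congr E; apply/funext => w; rewrite /D !mxE.
rewrite (@Ex_indep _ _ _ _ _ _ rX indX n f (fun M => M i j - A i j))//.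
  have := Ex_entry n i j; rewrite /D; under eq_fun do rewrite !mxE.
  by move=> ->; rewrite mulr0.
by have := @Ess n i j; rewrite /D; under eq_fun do rewrite !mxE.
Qed.

Let S n j k : R := E (fun w => \sum_i D n w i j * D n w i k).

Lemma Ex_cst_deviation_sqr n (x : 'cV[R]_d) :
  E (fun w => dotv (D n w *m x) (D n w *m x)) <= sigma ^+ 2 * dotv x x.
Proof.
have [->|x0] := eqVneq x 0.
  under eq_fun do rewrite mulmx0 dotv0r.
  by rewrite Ex_cst dotv0r mulr0.
have xx : 0 < dotv x x by rewrite lt_neqAle dotv_ge0 eq_sym dotv_eq0 x0.
pose f w := (dotv x x)^-1 * dotv (D n w *m x) (D n w *m x).
have bDx : bdd n.+1 (fun w => dotv (D n w *m x) (D n w *m x)).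
  by apply: bdd_dotv; apply: bdd_mxM;
    [exact: bdd_deviation|exact: bdd_mx_cst|exact: bdd_deviation|exact: bdd_mx_cst].
have bf : bdd n.+1 f by exact: bdd_adaptedZ.
have fle w : f w <= spectral_norm (X n w - A) ^+ 2.
  rewrite /f mulrC ler_pdivrMr// -!norm2_sqr -exprMn ler_sqr ?nnegrE ?norm2_ge0//.
    exact: norm2_mulmx_le.
  by apply: le_trans (norm2_ge0 _) (norm2_mulmx_le _ x).
have f0 w : 0 <= f w by rewrite mulr_ge0 ?invr_ge0 ?dotv_ge0.
suff : E f <= sigma ^+ 2.
  by rewrite (ExZ rX _ bDx) mulrC ler_pdivrMr.
rewrite -lee_fin /Ex /Rintegral fineK; last first.
  by apply: integrable_fin_num => //; exact: integrable_bdd bf.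
have := varX n; rewrite unlock => <-.
exact: le_integral_nonmeasurable.
Qed.

Let bdd_DD n i j k : bdd n.+1 (fun w => D n w i j * D n w i k).
Proof. by apply: bdd_adaptedM; exact: bdd_deviation. Qed.

Let dotv_deviation (M : 'M[R]_d) (x : 'cV[R]_d) :
  dotv (M *m x) (M *m x) =
  \sum_j \sum_k (x j 0 * x k 0) * \sum_i M i j * M i k.
Proof.
rewrite dotvE.
transitivity (\sum_i \sum_j \sum_k M i j * x j 0 * (M i k * x k 0)).
  apply: eq_bigr => i _; rewrite mxE big_distrl/=; apply: eq_bigr => j _.
  by rewrite big_distrr.
rewrite exchange_big/=; apply: eq_bigr => j _.
rewrite exchange_big/=; apply: eq_bigr => k _.
by rewrite mulr_sumr; apply: eq_bigr => i _; ring.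
Qed.

(** Independence replaces D^T D by its mean [S n] in the quadratic form of [v]. This deterministic
    matrix can then be evaluated at each fixed value of [v], where [Ex_cst_deviation_sqr] bounds it
    by sigma^2; no conditional expectation is needed. *)
Lemma Ex_deviation_sqr n (v : Omega -> 'cV[R]_d) : bdd_mx P X n v ->
  E (fun w => dotv (D n w *m v w) (D n w *m v w)) <=
  sigma ^+ 2 * E (fun w => dotv (v w) (v w)).
Proof.
move=> bv.
have bvv j k : bdd n (fun w => v w j 0 * v w k 0) by exact: bdd_adaptedM.
have n1 := leqnSn n.
have bDD j k : bdd n.+1 (fun w => \sum_i D n w i j * D n w i k).
  by apply: bdd_adapted_sum => i _.
have expand (f : 'I_d -> 'I_d -> Omega -> R) (g : 'I_d -> 'I_d -> R) :
    (forall j k, bdd n (f j k)) ->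
    E (fun w => \sum_j \sum_k f j k w * g j k) = \sum_j \sum_k E (f j k) * g j k.
  move=> bf; rewrite (Ex_sum rX (n := n)) => [|j _]; last first.
    apply: bdd_adapted_sum => k _; apply: bdd_adaptedM => //.
    exact: bdd_adapted_cst.
  apply: eq_bigr => j _; rewrite (Ex_sum rX (n := n)) => [|k _]; last first.
    by apply: bdd_adaptedM => //; exact: bdd_adapted_cst.
  apply: eq_bigr => k _; rewrite mulrC -(ExZ rX (n := n))//.
  by congr E; apply/funext => w; rewrite mulrC.
have -> : E (fun w => dotv (D n w *m v w) (D n w *m v w)) =
    \sum_j \sum_k E (fun w => v w j 0 * v w k 0) * S n j k.
  transitivity (E (fun w => \sum_j \sum_k (v w j 0 * v w k 0) *
      \sum_i D n w i j * D n w i k)).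
    by congr E; apply/funext => w; rewrite dotv_deviation.
  rewrite (Ex_sum rX (n := n.+1)) => [|j _]; last first.
    apply: bdd_adapted_sum => k _; apply: bdd_adaptedM => //.
    exact: bdd_adapted_le (bvv j k).
  apply: eq_bigr => j _; rewrite (Ex_sum rX (n := n.+1)) => [|k _]; last first.
    by apply: bdd_adaptedM => //; exact: bdd_adapted_le (bvv j k).
  apply: eq_bigr => k _.
  pose g (M : 'M[R]_d) := \sum_i (M i j - A i j) * (M i k - A i k).
  have gE w : g (X n w) = \sum_i D n w i j * D n w i k.
    by apply: eq_bigr => i _; rewrite /D !mxE.
  transitivity (E (fun w => (v w j 0 * v w k 0) * g (X n w))).
    by congr E; apply/funext => w; rewrite gE.
  rewrite (Ex_indep rX indX (n := n))//.
  - by congr (_ * E _); apply/funext => w; rewrite /= gE.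
  - by apply: measurable_sum => i; apply: measurable_funM; exact: measurable_entry.
  - have [_ [M HM]] := bDD j k; exists M.
    by apply: filterS HM => w; rewrite /= gE.
rewrite -(expand (fun j k w => v w j 0 * v w k 0))// -(ExZ rX (n := n)); last exact: bdd_dotv.
apply: (Ex_le rX (n := n)).
- apply: bdd_adapted_sum => j _; apply: bdd_adapted_sum => k _.
  by apply: bdd_adaptedM => //; exact: bdd_adapted_cst.
- by apply: bdd_adaptedZ; exact: bdd_dotv.
- move=> w; have := Ex_cst_deviation_sqr n (v w); apply: le_trans.
  rewrite le_eqVlt; apply/orP; left; apply/eqP.
  under [in RHS]eq_fun do rewrite dotv_deviation.
  rewrite (Ex_sum rX (n := n.+1)) => [|j _]; last first.
    by apply: bdd_adapted_sum => k _; exact: bdd_adaptedZ.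
  apply: eq_bigr => j _; rewrite (Ex_sum rX (n := n.+1)) => [|k _]; last first.
    exact: bdd_adaptedZ.
  by apply: eq_bigr => k _; rewrite (ExZ rX (n := n.+1)).
Qed.


Lemma Ex_dotv_deviation n (y v : Omega -> 'cV[R]_d) :
  bdd_mx P X n y -> bdd_mx P X n v -> E (fun w => dotv (y w) (D n w *m v w)) = 0.
Proof.
move=> By bv.
have bt i j : bdd n (fun w => y w i 0 * v w j 0) by exact: bdd_adaptedM.
transitivity (E (fun w => \sum_i \sum_j (y w i 0 * v w j 0) * D n w i j)).
  congr E; apply/funext => w; rewrite dotvE; apply: eq_bigr => i _.
  by rewrite mxE mulr_sumr; apply: eq_bigr => j _; ring.
have b2 i j : bdd n.+1 (fun w => (y w i 0 * v w j 0) * D n w i j).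
  by apply: bdd_adaptedM; [exact: bdd_adapted_le (bt i j)|exact: bdd_deviation].
rewrite (Ex_sum rX (n := n.+1)) => [|i _]; last exact: bdd_adapted_sum.
rewrite big1// => i _; rewrite (Ex_sum rX (n := n.+1)) => [|j _]; last exact: b2.
by rewrite big1// => j _; exact: Ex_deviation.
Qed.

Variable s : nat.
Hypothesis s_gt0 : (0 < s)%N.

Definition batch_noise (b : nat) (w : Omega) : 'M[R]_d :=
  batch_mean s (fun k => X k w) b - A.

Let batch_noiseE b w :
  batch_noise b w = s%:R^-1 *: \sum_(i < s) D (b * s + i) w.
Proof.
rewrite /batch_noise /batch_mean /D sumrB scalerBr; congr (_ - _).
rewrite sumr_const card_ord -[A *+ s]scaler_nat scalerA mulVf ?scale1r//.
by rewrite pnatr_eq0 -lt0n.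
Qed.

Lemma bdd_batch_noise b n : (b < n)%N -> bdd_mx P X (n * s) (batch_noise b).
Proof.
move=> bn; rewrite (_ : batch_noise b = fun w => s%:R^-1 *: \sum_(i < s) D (b * s + i) w).
  apply: bdd_mxZ; first exact: bdd_adapted_cst.
  apply: bdd_mx_sum => i; apply: bdd_deviation; have := ltn_ord i.
  have : (b.+1 * s <= n * s)%N by rewrite leq_mul2r bn orbT.
  rewrite mulSn; lia.
by apply/funext => w; exact: batch_noiseE.
Qed.

Let batch_noise_mul b w (v : 'cV[R]_d) :
  batch_noise b w *m v = s%:R^-1 *: \sum_(i < s) D (b * s + i) w *m v.
Proof. by rewrite batch_noiseE -scalemxAl mulmx_suml. Qed.

Lemma Ex_dotv_batch_noise b (y v : Omega -> 'cV[R]_d) :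
  bdd_mx P X (b * s) y -> bdd_mx P X (b * s) v ->
  E (fun w => dotv (y w) (batch_noise b w *m v w)) = 0.
Proof.
move=> By bv.
have le_bs i : (b * s <= b * s + i)%N by exact: leq_addr.
have Dv (i : 'I_s) : bdd_mx P X (b * s + s) (fun w => D (b * s + i) w *m v w).
  apply: bdd_mxM; first by apply: bdd_deviation; rewrite ltn_add2l.
  exact: bdd_mx_le (le_bs s) bv.
transitivity (E (fun w => s%:R^-1 * \sum_(i < s)
    dotv (y w) (D (b * s + i) w *m v w))).
  congr E; apply/funext => w; rewrite batch_noise_mul dotvZr; congr (_ * _).
  by rewrite (big_morph (dotv (y w)) (dotvDr (y w)) (dotv0r (y w))).
have bt i : bdd (b * s + s) (fun w => dotv (y w) (D (b * s + nat_of_ord (i : 'I_s)) w *m v w)).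
  by apply: bdd_dotv => //; exact: bdd_mx_le (le_bs s) By.
rewrite (ExZ rX (n := b * s + s)); last by apply: bdd_adapted_sum.
rewrite (Ex_sum rX (n := b * s + s))// big1 ?mulr0// => i _.
by apply: Ex_dotv_deviation; exact: bdd_mx_le (le_bs i) _.
Qed.

(** Each new sample is centered and independent of the partial sum [G m], so the second moments add
    up to at most s sigma^2 E|v|^2; averaging divides by s^2. *)
Lemma Ex_batch_noise_sqr b (v : Omega -> 'cV[R]_d) : bdd_mx P X (b * s) v ->
  E (fun w => dotv (batch_noise b w *m v w) (batch_noise b w *m v w)) <=
  sigma ^+ 2 / s%:R * E (fun w => dotv (v w) (v w)).
Proof.
move=> bv; pose G m w := \sum_(i < m) D (b * s + i) w *m v w.
have le_bs i : (b * s <= b * s + i)%N by exact: leq_addr.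
have bDv i m : (i < m)%N -> bdd_mx P X (b * s + m) (fun w => D (b * s + i) w *m v w).
  move=> im; apply: bdd_mxM; first by apply: bdd_deviation; rewrite ltn_add2l.
  exact: bdd_mx_le (le_bs m) bv.
have bG m : bdd_mx P X (b * s + m) (G m).
  by apply: bdd_mx_sum => i; exact: bDv.
have GE m : E (fun w => dotv (G m w) (G m w)) <=
    m%:R * (sigma ^+ 2 * E (fun w => dotv (v w) (v w))).
  elim: m => [|m IH].
    rewrite /G; under eq_fun do rewrite big_ord0 dotv0r.
    by rewrite Ex_cst mul0r.
  pose H w := D (b * s + m) w *m v w.
  have bH : bdd_mx P X (b * s + m.+1) H by exact: bDv.
  have bG' : bdd_mx P X (b * s + m.+1) (G m).
    by apply: bdd_mx_le (bG m); rewrite leq_add2l.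
  have GG : bdd (b * s + m.+1) (fun w => dotv (G m w) (G m w)) by exact: bdd_dotv.
  have GH : bdd (b * s + m.+1) (fun w => 2 * dotv (G m w) (H w)).
    by apply: bdd_adaptedZ; exact: bdd_dotv.
  have HH : bdd (b * s + m.+1) (fun w => dotv (H w) (H w)) by exact: bdd_dotv.
  rewrite (_ : (fun w => _) = fun w =>
    dotv (G m w) (G m w) + 2 * dotv (G m w) (H w) + dotv (H w) (H w)); last first.
    apply/funext => w; rewrite /G big_ord_recr/= -/(G m w) -/(H w).
    by rewrite dotvDr !dotvDl [dotv (H w) (G m w)]dotvC; ring.
  rewrite (ExD rX (bdd_adaptedD GG GH) HH) (ExD rX GG GH).
  rewrite (ExZ rX (n := b * s + m.+1)); last exact: bdd_dotv.
  rewrite /H Ex_dotv_deviation//; last exact: bdd_mx_le (le_bs m) bv.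
  rewrite mulr0 addr0 -natr1 mulrDl mul1r lerD//.
  by apply: Ex_deviation_sqr; exact: bdd_mx_le (le_bs m) bv.
have s0 : 0 < s%:R :> R by rewrite ltr0n.
have -> : E (fun w => dotv (batch_noise b w *m v w) (batch_noise b w *m v w)) =
    s%:R^-1 ^+ 2 * E (fun w => dotv (G s w) (G s w)).
  rewrite -(ExZ rX (n := b * s + s)); last exact: bdd_dotv.
  congr E; apply/funext => w; rewrite batch_noise_mul dotvZl dotvZr -/(G s w).
  by rewrite mulrA expr2.
apply: le_trans (ler_wpM2l _ (GE s)) _; first exact: sqr_ge0.
by rewrite le_eqVlt; apply/orP; left; apply/eqP; field; rewrite gt_eqF.
Qed.

End batch_moments.

(** * One epoch, pathwise *)

Section stopped_process.
Context {R : realType} {d : nat}.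
Variables (A : 'M[R]_d) (lambda : 'I_d -> R) (u : 'I_d -> 'cV[R]_d) (i0 : 'I_d).
Variable b : R.
Hypothesis symA : A^T = A.
Hypothesis eigA : forall i, A *m u i = lambda i *: u i.
Hypothesis ou : orthonormal_family u.
Hypotheses (b0 : 0 <= b) (blam : 2 * b < lambda i0).
Hypothesis lambda_small : forall i, i != i0 -> 0 <= lambda i <= 2 * b.

Let lam := lambda i0.
Let beta := b ^+ 2.
Let u1 := u i0.
Let zm := zminus lam b.
Let zp := zplus lam b.
Let p i := cheb beta (lambda i).
Let q := cheb beta lam.

(** Since z_+ + z_- = lambda_1 and z_+ z_- = beta, this combination decouples the growing root:
    without noise it is multiplied by z_+ at each step. *)
Definition leading (y : 'cV[R]_d * 'cV[R]_d) := dotv u1 y.2 - zm * dotv u1 y.1.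

Definition masked (a : 'cV[R]_d) (y : 'cV[R]_d * 'cV[R]_d) : 'cV[R]_d :=
  (0 < leading y)%R%:R *: (y.2 - dotv y.2 a *: a).

(* The unnormalized inner iteration started from y0, with the noise N switched
   off once the growing mode [leading] is no longer positive. *)
Fixpoint stopped (N : nat -> 'M[R]_d) (a y0 : 'cV[R]_d) (t : nat) :=
  if t is t'.+1 then
    let y := stopped N a y0 t' in
    (y.2, A *m y.2 - beta *: y.1 + N t' *m masked a y)
  else (0, y0).

Lemma dotv_eigA i y : dotv (u i) (A *m y) = lambda i * dotv (u i) y.
Proof. by rewrite dotv_mulmx_sym// eigA dotvZl. Qed.

Section path.
Variables (N : nat -> 'M[R]_d) (a y0 : 'cV[R]_d).
Let Y := stopped N a y0.
Let xi t := N t *m masked a (Y t).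

Lemma stopped_coord i t : dotv (u i) (Y t).2 =
  p i t * dotv (u i) y0 + \sum_(j < t) p i (t.-1 - j) * dotv (u i) (xi j).
Proof.
apply: (cheb_duhamel (y := fun t => dotv (u i) (Y t).2)
  (e := fun t => dotv (u i) (xi t))) => [|k] /=.
  by rewrite scaler0 subr0 dotvDr dotv_eigA.
by rewrite dotvDr dotvBr dotv_eigA dotvZr.
Qed.

Let leading_rec t : leading (Y t.+1) = zp * leading (Y t) + dotv u1 (xi t).
Proof.
rewrite /leading /= dotvDr dotvBr dotv_eigA dotvZr -/lam /beta.
rewrite -(zplus_add_zminus lam b) -(zplus_mul_zminus b0 blam) -/zp -/zm -/(xi t) -/(Y t).
ring.
Qed.

Lemma leading_duhamel t : leading (Y t) =
  zp ^+ t * dotv u1 y0 + \sum_(j < t) zp ^+ (t.-1 - j) * dotv u1 (xi j).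
Proof.
have -> : dotv u1 y0 = leading (Y 0%N) by rewrite /leading /= dotv0r mulr0 subr0.
exact: (geometric_duhamel (y := fun t => leading (Y t))
  (e := fun t => dotv u1 (xi t)) leading_rec).
Qed.

(** Contrapositive: a nonpositive mode switches the noise off and is then only multiplied by z_+ >
    0, so it stays nonpositive. *)
Lemma leading_gt0_prev t : 0 < leading (Y t.+1) -> 0 < leading (Y t).
Proof.
rewrite leading_rec => H; apply: contraT => /negbTE nl; move: H.
rewrite /xi /masked nl scale0r mulmx0 dotv0r addr0.
have := zplus_gt0 b0 blam; rewrite -/zp => zp0.
by rewrite pmulr_rgt0// nl.
Qed.

(** u_1^T y_t = l_t + z_- u_1^T y_{t-1} with z_- >= 0, and positivity of the mode is inherited by
    all earlier times. *)
Lemma leading_gt0_coord t : 0 < leading (Y t) -> 0 < dotv u1 (Y t).2.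
Proof.
elim: t => [|t IH] H.
  by move: H; rewrite /leading /= dotv0r mulr0 subr0.
have yt := IH (leading_gt0_prev H).
move: H; rewrite /leading /= -/(Y t) subr_gt0; apply: le_lt_trans.
by rewrite mulr_ge0 ?(zminus_ge0 b0 blam)// ltW.
Qed.

End path.

(** For a fixed anchor the inner step is linear in the pair before normalization, and both
    components are divided by the same norm. Hence only a positive factor separates the two
    processes while the mode is positive; that norm is nonzero because the coordinate along u_1 is
    positive. *)
Lemma vr_inner_stopped (M : nat -> 'M[R]_d) (a : 'cV[R]_d) (phi : R) t :
  0 < phi -> let Y := stopped (fun t => M t - A) a (phi *: a) in
  0 < leading (Y t) ->
  exists2 c, 0 < c & vr_inner A beta M a t = (c *: (Y t).1, c *: (Y t).2) /\
    ((0 < t)%N -> norm2 (c *: (Y t).2) = 1).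
Proof.
move=> phi0 Y; elim: t => [|t IH] H.
  exists phi^-1; first by rewrite invr_gt0.
  by rewrite /= scaler0 scalerA mulVf ?gt_eqF// scale1r.
have [c c0 [innE _]] := IH (leading_gt0_prev H).
have lt0 := leading_gt0_prev H.
have yn0 : 0 < norm2 (Y t.+1).2.
  rewrite lt_neqAle norm2_ge0 eq_sym norm2_eq0 andbT; apply/eqP => y0.
  by have := leading_gt0_coord H; rewrite -/Y y0 dotv0r ltxx.
have cy0 : 0 < norm2 (c *: (Y t.+1).2) by rewrite norm2Z gtr0_norm// mulr_gt0.
exists ((norm2 (c *: (Y t.+1).2))^-1 * c); first by rewrite mulr_gt0 ?invr_gt0.
split => [|_]; last first.
  by rewrite -scalerA norm2Z gtr0_norm ?invr_gt0// mulVf ?gt_eqF.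
rewrite /= innE /vr_step /=.
(* With N = M - A, M(w - alpha a) + alpha A a = A w + N(w - alpha a): the exact product removes the
   noise along the anchor. *)
have -> : M t *m (c *: (Y t).2 - dotv (c *: (Y t).2) a *: a) +
    dotv (c *: (Y t).2) a *: (A *m a) - beta *: (c *: (Y t).1) = c *: (Y t.+1).2.
  rewrite /Y /= -/Y /masked lt0 scale1r dotvZl mulmxBl !mulmxBr -!scalemxAr.
  rewrite -!scalerA; apply/matrixP => i j; rewrite !mxE; ring.
by rewrite !scalerA.
Qed.

Section path_bounds.
Variables (N : nat -> 'M[R]_d) (a : 'cV[R]_d) (phi : R) (T : nat).
Let Y := stopped N a (phi *: a).
Let C := dotv u1 a.
Hypotheses (a1 : dotv a a = 1) (C0 : 0 < C) (phi_gt0 : 0 < phi).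
Hypothesis ratio : forall i, i != i0 -> p i T ^+ 2 <= 593 / 1000 * q T ^+ 2.

Definition noise_coord i t := \sum_(j < t) p i (t.-1 - j) * dotv (u i) (N j *m masked a (Y j)).

Let W := (\sum_i noise_coord i T ^+ 2) / q T ^+ 2.
Let Sp := \sum_(i | i != i0) dotv (u i) (Y T).2 ^+ 2.
Let X0 := dotv u1 (Y T).2.
Let Np := \sum_(i | i != i0) noise_coord i T ^+ 2.
Let n0 := noise_coord i0 T.

Let qT0 : 0 < q T. Proof. exact: cheb_gt0. Qed.

Lemma one_sub_leading_coord : 1 - C ^+ 2 = \sum_(i | i != i0) dotv (u i) a ^+ 2.
Proof.
have := a1; rewrite (dotv_orthonormal ou) (bigD1 i0)//= -/u1 -/C -expr2 => <-.
by rewrite [X in X - _]addrC addrK; apply: eq_bigr => i _; rewrite expr2.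
Qed.

Let Sp_le g : 0 < g ->
  Sp <= (1 + g) * (593 / 1000 * (phi ^+ 2 * q T ^+ 2 * (1 - C ^+ 2))) + (1 + g^-1) * Np.
Proof.
move=> g0; rewrite one_sub_leading_coord /Sp /Np !mulr_sumr -big_split/=.
apply: ler_sum => i ii0; rewrite stopped_coord dotvZr -/(noise_coord i T).
set n := noise_coord i T; set x := dotv (u i) a.
have young (y z : R) : (y + z) ^+ 2 <= (1 + g) * y ^+ 2 + (1 + g^-1) * z ^+ 2.
  rewrite -subr_ge0.
  have -> : (1 + g) * y ^+ 2 + (1 + g^-1) * z ^+ 2 - (y + z) ^+ 2 =
     g^-1 * (g * y - z) ^+ 2 by field; rewrite gt_eqF.
  by rewrite mulr_ge0 ?sqr_ge0// invr_ge0 ltW.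
apply: le_trans (young _ _) _; rewrite lerD2r ler_wpM2l//; first lra.
have -> : (p i T * (phi * x)) ^+ 2 = (phi ^+ 2 * x ^+ 2) * p i T ^+ 2 by ring.
have -> : 593 / 1000 * (phi ^+ 2 * q T ^+ 2 * x ^+ 2) =
  (phi ^+ 2 * x ^+ 2) * (593 / 1000 * q T ^+ 2) by ring.
by rewrite ler_wpM2l ?ratio// mulr_ge0 ?sqr_ge0.
Qed.

Let WE : n0 ^+ 2 + Np = W * q T ^+ 2.
Proof. by rewrite /W divfK ?gt_eqF ?exprn_gt0// (bigD1 i0). Qed.

Let X0E : X0 = phi * q T * C + n0.
Proof. by rewrite /X0 stopped_coord dotvZr -/(noise_coord i0 T) -/n0 -/u1 -/C -/q; ring. Qed.

Let Sp_ge0 : 0 <= Sp. Proof. by apply: sumr_ge0 => i _; exact: sqr_ge0. Qed.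
(** Young's inequality with weight 1/10 separates signal and noise in both [Sp] and [X0]. The
    constants are (11/10)^2 (593/1000) <= 72/100 and (11/10) 11 = 121/10; [tau <= 1] keeps the noise
    of the denominator from being amplified. *)
Lemma contraction_step : 0 < X0 -> Sp <= X0 ^+ 2 ->
  phi ^+ 2 * C ^+ 2 * (Sp / X0 ^+ 2) <=
  72 / 100 * (phi ^+ 2 * (1 - C ^+ 2)) + 121 / 10 * W.
Proof.
move=> X00 SX; set tau := Sp / X0 ^+ 2.
have X2 : 0 < X0 ^+ 2 by rewrite exprn_gt0.
have tau1 : tau <= 1 by rewrite ler_pdivrMr// mul1r.
have tau0 : 0 <= tau by rewrite divr_ge0// ltW.
have tauX : tau * X0 ^+ 2 = Sp by rewrite divfK ?gt_eqF.
have q2 : 0 < q T ^+ 2 by rewrite exprn_gt0.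
have S0 : 0 <= phi ^+ 2 * q T ^+ 2 * (1 - C ^+ 2).
  rewrite one_sub_leading_coord; apply: mulr_ge0.
    by apply: mulr_ge0; exact: sqr_ge0.
  by apply: sumr_ge0 => i _; exact: sqr_ge0.
have g0 : 0 < 1 / 10 :> R by lra.
have := Sp_le g0; have -> : (1 / 10)^-1 = 10 :> R by field.
move=> H.
pose g := phi * q T * C.
have gX : g ^+ 2 * (10 / 11) <= X0 ^+ 2 + 10 * n0 ^+ 2.
  rewrite X0E -/g -subr_ge0.
  have -> : (g + n0) ^+ 2 + 10 * n0 ^+ 2 - g ^+ 2 * (10 / 11) =
    (g + 11 * n0) ^+ 2 / 11 by field.
  by rewrite divr_ge0 ?sqr_ge0.
have h1 : tau * (g ^+ 2 * (10 / 11)) <= Sp + 10 * n0 ^+ 2.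
  apply: le_trans (ler_wpM2l tau0 gX) _; rewrite mulrDr tauX lerD2l.
  by rewrite ler_piMl// mulr_ge0 ?sqr_ge0.
have n2 := sqr_ge0 n0.
rewrite -(ler_pM2r q2) [leRHS]mulrDl -[121 / 10 * W * _]mulrA -WE.
have -> : phi ^+ 2 * C ^+ 2 * tau * q T ^+ 2 = tau * g ^+ 2 by rewrite /g; ring.
have -> : 72 / 100 * (phi ^+ 2 * (1 - C ^+ 2)) * q T ^+ 2 =
  72 / 100 * (phi ^+ 2 * q T ^+ 2 * (1 - C ^+ 2)) by ring.
move: h1 H; rewrite mulrA; lra.
Qed.

(* Young's inequality is applied to X0 and to Sp with weights for which both
   noise terms get the coefficient 26/3; 13/10 * 593/1000 <= 771/1000. *)
Lemma escape_step : 0 < X0 -> X0 ^+ 2 < Sp ->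
  phi ^+ 2 * (C ^+ 2 - 771 / 1000 * (1 - C ^+ 2)) <= 26 / 3 * W.
Proof.
move=> X00 SX; have q2 : 0 < q T ^+ 2 by rewrite exprn_gt0.
have g0 : 0 < 3 / 20 :> R by lra.
have := Sp_le g0; have -> : (3 / 20)^-1 = 20 / 3 :> R by field.
move=> H.
pose g := phi * q T * C.
have gX : g ^+ 2 <= 26 / 23 * X0 ^+ 2 + 26 / 3 * n0 ^+ 2.
  rewrite X0E -/g -subr_ge0.
  have -> : 26 / 23 * (g + n0) ^+ 2 + 26 / 3 * n0 ^+ 2 - g ^+ 2 =
    (3 * g + 26 * n0) ^+ 2 / 69 by field.
  by rewrite divr_ge0 ?sqr_ge0.
rewrite -(ler_pM2r q2) -[26 / 3 * W * _]mulrA -WE.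
have -> : phi ^+ 2 * (C ^+ 2 - 771 / 1000 * (1 - C ^+ 2)) * q T ^+ 2 =
  g ^+ 2 - 771 / 1000 * (phi ^+ 2 * q T ^+ 2 * (1 - C ^+ 2)) by rewrite /g; ring.
have S0 : 0 <= phi ^+ 2 * q T ^+ 2 * (1 - C ^+ 2).
  rewrite one_sub_leading_coord; apply: mulr_ge0.
    by apply: mulr_ge0; exact: sqr_ge0.
  by apply: sumr_ge0 => i _; exact: sqr_ge0.
move: H gX SX S0; lra.
Qed.

(** Pathwise form of Chebyshev's inequality: the accumulated noise must cancel the drift z_+^T phi
    C, so its square is at least the square of the drift. *)
Lemma stopping_step : leading (Y T) <= 0 ->
  phi ^+ 2 * C ^+ 2 <=
  (\sum_(j < T) zp ^+ (T.-1 - j) * dotv u1 (N j *m masked a (Y j))) ^+ 2 / zp ^+ T ^+ 2.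
Proof.
rewrite leading_duhamel dotvZr -/C; set Z := \sum_(j < T) _ => H.
have z0 : 0 < zp ^+ T by rewrite exprn_gt0// zplus_gt0.
rewrite ler_pdivlMr; last by rewrite exprn_gt0.
have -> : phi ^+ 2 * C ^+ 2 * (zp ^+ T) ^+ 2 = (zp ^+ T * (phi * C)) ^+ 2 by ring.
rewrite -[Z ^+ 2]sqrrN.
rewrite ler_sqr ?nnegrE; [lra| |].
  by rewrite mulr_ge0 ?mulr_ge0// ltW.
suff : 0 <= zp ^+ T * (phi * C) by lra.
by rewrite !mulr_ge0// ltW.
Qed.

End path_bounds.
End stopped_process.

(** * One epoch, second moments *)

(** [cheb_small] is compared with [cheb_lower], from which the linear Taylor term is dropped. *)
Lemma cheb_le_dominant (R : realType) (lam b x : R) t :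
  0 <= b -> 2 * b < lam -> 0 <= x <= 2 * b ->
  `|cheb (b ^+ 2) x t| <= cheb (b ^+ 2) lam t.
Proof.
move=> b0 blam xb; have q0 := cheb_gt0 b0 blam t.
case: t q0 => [|t] q0; first by rewrite !cheb0 normr1.
apply: le_trans (cheb_small _ xb) _.
have [b00|bn0] := eqVneq b 0; first by rewrite {1}b00 expr0n mulr0 ltW.
have bp : 0 < b by rewrite lt_neqAle eq_sym bn0.
have b2 : 0 < 2 * b by rewrite mulr_gt0.
rewrite -(ler_pM2l b2); apply: le_trans (cheb_lower b0 blam _).
set B := b ^+ t.+1; have -> : 2 * b * (t.+2%:R * B) = B * (2 * b * t.+2%:R) by ring.
rewrite ler_wpM2l ?exprn_ge0// lerDl divr_ge0//.
rewrite mulr_ge0//; first lra.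
by rewrite subr_ge0 exprS ler_peMr ?ler0n// -natrX ler1n expn_gt0.
Qed.

Section epoch_moments.
Context {R : realType} {dT : measure_display} {Omega : measurableType dT}.
Variables (P : probability Omega R) (d : nat) (X : nat -> Omega -> 'M[R]_d).
Variables (A : 'M[R]_d) (r sigma : R).
Hypothesis iidX : iid P X.
Hypothesis meanX : forall k, mx_mean P (X k) A.
Hypothesis boundX : forall k, {ae P, forall w, spectral_norm (X k w) <= r}.
Hypothesis varX : forall k,
  ('E_P[fun w => (spectral_norm (X k w - A) ^+ 2)%R] = (sigma ^+ 2)%:E)%E.
Variables (lambda : 'I_d -> R) (u : 'I_d -> 'cV[R]_d) (i0 : 'I_d) (b : R).
Hypothesis symA : A^T = A.
Hypothesis eigA : forall i, A *m u i = lambda i *: u i.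
Hypothesis ou : orthonormal_family u.
Hypotheses (b0 : 0 <= b) (blam : 2 * b < lambda i0).
Hypothesis lambda_small : forall i, i != i0 -> 0 <= lambda i <= 2 * b.
Variable s : nat.
Hypothesis s_gt0 : (0 < s)%N.
Variables (m : nat) (a : Omega -> 'cV[R]_d) (phi : Omega -> R).

Local Notation bdd := (bdd_adapted P X).
Local Notation E := (Ex P).
Let lam := lambda i0.
Let beta := b ^+ 2.
Let u1 := u i0.
Let zp := zplus lam b.
Let D := cheb_gap lam b.
Let p i := cheb beta (lambda i).
Let q := cheb beta lam.
Let C w := dotv u1 (a w).

Hypothesis bdd_a : bdd_mx P X (m * s) a.
Hypothesis bdd_phi : bdd (m * s) phi.
Hypothesis a_unit : forall w, dotv (a w) (a w) = 1.
Hypothesis a_half : forall w, 1 / 2 <= C w ^+ 2.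

Let rX n : random_mx (X n). Proof. by have [] := iidX. Qed.

(** Batch [m + t] starts at sample [(m + t) * s]. The state before inner step [t] is adapted to that
    level, and the anchor and the weight already to level [m * s]. *)
Definition epoch_noise t w := batch_noise X A s (m + t) w.
Definition epoch_path t w :=
  stopped A lambda u i0 b (epoch_noise ^~ w) (a w) (phi w *: a w) t.
Let N := epoch_noise.
Let Y := epoch_path.
Let v t w := masked lambda u i0 b (a w) (Y t w).
Let e i t w := dotv (u i) (N t w *m v t w).
Let nc i t w := noise_coord A lambda u i0 b (N ^~ w) (a w) (phi w) i t.

Let lv t : (m * s <= (m + t) * s)%N. Proof. by rewrite leq_mul2r leq_addr orbT. Qed.
Let lvS t : ((m + t) * s <= (m + t.+1) * s)%N.
Proof. by rewrite leq_mul2r leq_add2l leqnSn orbT. Qed.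

Let bdd_u n i : bdd_mx P X n (fun=> u i). Proof. exact: bdd_mx_cst. Qed.

Lemma bdd_epoch_path t : bdd_mx P X ((m + t) * s) (fun w => (Y t w).1) /\
  bdd_mx P X ((m + t) * s) (fun w => (Y t w).2).
Proof.
elim: t => [|t [IH1 IH2]].
  rewrite addn0; split; first exact: bdd_mx_cst.
  by apply: bdd_mxZ.
have ba := bdd_mx_le (lv t) bdd_a.
split; first exact: bdd_mx_le (lvS t) IH2.
have bA : bdd_mx P X ((m + t) * s) (fun w => A *m (Y t w).2 - beta *: (Y t w).1).
  apply: bdd_mxB; first by apply: bdd_mxM => //; exact: bdd_mx_cst.
  by apply: bdd_mxZ => //; exact: bdd_adapted_cst.
apply: bdd_mxD; first exact: bdd_mx_le (lvS t) bA.
apply: bdd_mxM; first by apply: bdd_batch_noise => //; rewrite addnS.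
apply: (bdd_mx_le (lvS t)); apply: bdd_mxZ.
  apply: bdd_adapted_pos.
  have : bdd ((m + t) * s) (fun w => leading lambda u i0 b (Y t w)).
    apply: bdd_adaptedB; first exact: bdd_dotv.
    by apply: bdd_adaptedZ; exact: bdd_dotv.
  by case.
by apply: bdd_mxB => //; apply: bdd_mxZ => //; exact: bdd_dotv.
Qed.

Let bdd_v t : bdd_mx P X ((m + t) * s) (v t).
Proof.
have [IH1 IH2] := bdd_epoch_path t; have ba := bdd_mx_le (lv t) bdd_a.
apply: bdd_mxZ.
  apply: bdd_adapted_pos.
  have : bdd ((m + t) * s) (fun w => leading lambda u i0 b (Y t w)).
    apply: bdd_adaptedB; first exact: bdd_dotv.
    by apply: bdd_adaptedZ; exact: bdd_dotv.
  by case.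
by apply: bdd_mxB => //; apply: bdd_mxZ => //; exact: bdd_dotv.
Qed.

Let bdd_e i t : bdd ((m + t.+1) * s) (e i t).
Proof.
apply: bdd_dotv => //; apply: bdd_mxM; last exact: bdd_mx_le (lvS t) (bdd_v t).
by apply: bdd_batch_noise => //; rewrite addnS.
Qed.

Let Ex_mul_e i t f : bdd ((m + t) * s) f -> E (fun w => f w * e i t w) = 0.
Proof.
move=> bf; rewrite -[RHS](Ex_dotv_batch_noise iidX meanX boundX s_gt0
  (b := m + t) (y := fun w => f w *: u i) (v := v t)); last 2 first.
- exact: bdd_mxZ.
- exact: bdd_v.
by congr E; apply/funext => w; rewrite dotvZl.
Qed.

Let bdd_sum_e i (c : nat -> R) t :
  bdd ((m + t) * s) (fun w => \sum_(j < t) c j * e i j w).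
Proof.
apply: bdd_adapted_sum => j _; apply: bdd_adaptedZ.
apply: bdd_adapted_le (bdd_e i j).
by rewrite leq_mul2r leq_add2l ltn_ord orbT.
Qed.

Let Ex_mul_sum_e i (c : nat -> R) t f : bdd (m * s) f ->
  E (fun w => f w * \sum_(j < t) c j * e i j w) = 0.
Proof.
move=> bf; have bfe j : (j < t)%N -> bdd ((m + t) * s) (fun w => f w * e i j w).
  move=> jt; apply: bdd_adaptedM; first exact: bdd_adapted_le (lv t) bf.
  apply: bdd_adapted_le (bdd_e i j).
  by rewrite leq_mul2r leq_add2l jt orbT.
transitivity (E (fun w => \sum_(j < t) c j * (f w * e i j w))).
  congr E; apply/funext => w; rewrite mulr_sumr; apply: eq_bigr => j _; ring.
rewrite (Ex_sum rX (n := (m + t) * s)) => [|j _]; last exact/bdd_adaptedZ/bfe.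
rewrite big1// => j _; rewrite (ExZ rX (n := (m + t) * s)); last exact: bfe.
by rewrite Ex_mul_e ?mulr0//; exact: bdd_adapted_le (lv j) bf.
Qed.

(** Martingale differences are orthogonal: the newest term is centered given the samples that
    determine the partial sum before it. *)
Lemma Ex_sum_sqr i (c : nat -> R) t :
  E (fun w => (\sum_(j < t) c j * e i j w) ^+ 2) =
  \sum_(j < t) c j ^+ 2 * E (fun w => e i j w ^+ 2).
Proof.
elim: t => [|t IH].
  by under eq_fun do rewrite big_ord0 expr0n; rewrite Ex_cst big_ord0.
rewrite big_ord_recr/= -IH.
pose S w := \sum_(j < t) c j * e i j w.
have bS : bdd ((m + t.+1) * s) S by exact: bdd_adapted_le (lvS t) (bdd_sum_e i c t).
have bS2 := bdd_adaptedX bS.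
have bSe : bdd ((m + t.+1) * s) (fun w => S w * e i t w) by exact: bdd_adaptedM.
have be2 := bdd_adaptedX (bdd_e i t).
transitivity (E (fun w => S w ^+ 2 + 2 * c t * (S w * e i t w) + c t ^+ 2 * e i t w ^+ 2)).
  congr E; apply/funext => w; rewrite big_ord_recr/= -/(S w); ring.
rewrite (ExD rX (bdd_adaptedD bS2 (bdd_adaptedZ _ bSe)) (bdd_adaptedZ _ be2)).
rewrite (ExD rX bS2 (bdd_adaptedZ _ bSe)) (ExZ rX _ bSe) (ExZ rX _ be2).
by rewrite Ex_mul_e ?mulr0 ?addr0//; exact: bdd_sum_e.
Qed.

Let V t := \sum_i E (fun w => e i t w ^+ 2).
Let Phi := E (fun w => phi w ^+ 2 * (C w ^+ 2 * (1 - C w ^+ 2))).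
Let eta := sigma ^+ 2 / s%:R.
Let h := eta / D ^+ 2.

Let V_le t : V t <= eta * E (fun w => dotv (v t w) (v t w)).
Proof.
apply: le_trans (Ex_batch_noise_sqr iidX meanX boundX varX s_gt0 (bdd_v t)).
rewrite le_eqVlt; apply/orP; left; apply/eqP.
rewrite /V -(Ex_sum rX (n := (m + t.+1) * s)) => [|i _]; last exact/bdd_adaptedX.
congr E; apply/funext => w; rewrite (dotv_orthonormal ou).
by apply: eq_bigr => i _; rewrite expr2.
Qed.

(** The epoch starts on the line of the anchor, which I - a a^T annihilates, so the first inner step
    is noise-free. This is why the growth exponent is [t.-1] below. *)
Let V0 : V 0%N = 0.
Proof.
have e0 i : (fun w => e i 0%N w ^+ 2) = fun=> 0.
  apply/funext => w; rewrite /e /v /masked /= dotvZl a_unit mulr1 subrr scaler0.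
  by rewrite mulmx0 dotv0r expr0n.
by rewrite /V big1// => i _; rewrite e0 Ex_cst.
Qed.

Let C_le1 w : C w ^+ 2 <= 1.
Proof.
rewrite -(a_unit w) (dotv_orthonormal ou) (bigD1 i0)//= -/u1 -/(C w) expr2.
by rewrite lerDl sumr_ge0// => i _; rewrite -expr2 sqr_ge0.
Qed.

Let p_le i t : `|p i t| <= q t.
Proof.
have [->|ii0] := eqVneq i i0; first by rewrite ger0_norm// ltW// cheb_gt0.
by apply: cheb_le_dominant => //; exact: lambda_small.
Qed.

Let sqr_p_le i t : p i t ^+ 2 <= q t ^+ 2.
Proof.
rewrite -real_normK ?num_real// ler_sqr ?nnegrE//.
by rewrite ltW// cheb_gt0.
Qed.

Let al i w := dotv (u i) (a w).
Let mu t w := \sum_i p i t * al i w ^+ 2.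
Let cross i t w := 2 * phi w * (p i t - mu t w) * al i w.

Let al_sum w : \sum_i al i w ^+ 2 = 1.
Proof.
by rewrite -(a_unit w) (dotv_orthonormal ou); apply: eq_bigr => i _; rewrite expr2.
Qed.

(* Bhatia-Davis: the variance of p under the spectral weights al^2 is at most
   q^2 - mu^2, and mu >= q (2 C^2 - 1). *)
Let variance_le t w :
  \sum_i (p i t * al i w) ^+ 2 - mu t w ^+ 2 <=
  4 * q t ^+ 2 * (C w ^+ 2 * (1 - C w ^+ 2)).
Proof.
have q0 : 0 < q t := cheb_gt0 b0 blam t.
have h1 : \sum_i (p i t * al i w) ^+ 2 <= q t ^+ 2.
  rewrite -[leRHS]mulr1 -(al_sum w) mulr_sumr; apply: ler_sum => i _.
  by rewrite exprMn ler_wpM2r ?sqr_ge0.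
have h2 : q t * (2 * C w ^+ 2 - 1) <= mu t w.
  have -> : q t * (2 * C w ^+ 2 - 1) = q t * C w ^+ 2 - q t * (1 - C w ^+ 2) by ring.
  have -> : 1 - C w ^+ 2 = \sum_(i | i != i0) al i w ^+ 2.
    by rewrite -(al_sum w) (bigD1 i0)//= -/(C w) [X in X - _]addrC addrK.
  rewrite /mu [leRHS](bigD1 i0)//=; apply: lerD => //; rewrite mulr_sumr -sumrN.
  apply: ler_sum => i _; rewrite -mulNr ler_wpM2r ?sqr_ge0//.
  by have := p_le i t; rewrite ler_norml => /andP[].
have h3 : 0 <= q t * (2 * C w ^+ 2 - 1).
  by rewrite mulr_ge0 ?(ltW q0)//; have := a_half w; lra.
have h4 : (q t * (2 * C w ^+ 2 - 1)) ^+ 2 <= mu t w ^+ 2.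
  by rewrite ler_sqr ?nnegrE//; exact: le_trans h3 h2.
have -> : 4 * q t ^+ 2 * (C w ^+ 2 * (1 - C w ^+ 2)) =
  q t ^+ 2 - (q t * (2 * C w ^+ 2 - 1)) ^+ 2 by ring.
lra.
Qed.

(** |(I - a a^T) y|^2 = |y|^2 - (a^T y)^2. Its noise-free part is a variance of p under the spectral
    weights; the part linear in the noise has coefficients [cross] known at the start of the epoch,
    hence mean zero; of the quadratic part, the negative square is dropped. *)
Let masked_sqr_le t w : dotv (v t w) (v t w) <=
  4 * q t ^+ 2 * (phi w ^+ 2 * (C w ^+ 2 * (1 - C w ^+ 2))) +
  \sum_i cross i t w * nc i t w + \sum_i nc i t w ^+ 2.
Proof.
pose y := (Y t w).2.
have yi i : dotv (u i) y = phi w * (p i t * al i w) + nc i t w.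
  by rewrite /y /Y /epoch_path (stopped_coord _ _ symA eigA)// dotvZr mulrCA.
have h1 : dotv (v t w) (v t w) <= dotv y y - dotv y (a w) ^+ 2.
  have -> : dotv y y - dotv y (a w) ^+ 2 =
    dotv (y - dotv y (a w) *: a w) (y - dotv y (a w) *: a w).
    rewrite dotvBr !dotvBl !dotvZr !dotvZl a_unit [dotv (a w) y]dotvC; ring.
  rewrite /v /masked -/y dotvZl dotvZr; case: (0 < _)%R => /=.
    by rewrite !mul1r.
  by rewrite !mul0r dotv_ge0.
apply: le_trans h1 _.
have yy : dotv y y = phi w ^+ 2 * \sum_i (p i t * al i w) ^+ 2 +
    2 * phi w * (\sum_i p i t * al i w * nc i t w) + \sum_i nc i t w ^+ 2.
  rewrite (dotv_orthonormal ou) !mulr_sumr -!big_split/=.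
  by apply: eq_bigr => i _; rewrite !yi; ring.
have ya : dotv y (a w) = phi w * mu t w + \sum_i al i w * nc i t w.
  rewrite (dotv_orthonormal ou) mulr_sumr -big_split/=.
  by apply: eq_bigr => i _; rewrite yi -/(al i w); ring.
have crossE : \sum_i cross i t w * nc i t w =
    2 * phi w * (\sum_i p i t * al i w * nc i t w) -
    2 * phi w * mu t w * (\sum_i al i w * nc i t w).
  rewrite /cross; move: (mu t w) => M; rewrite !mulr_sumr -sumrB.
  by apply: eq_bigr => i _; ring.
rewrite yy ya crossE.
set Z := \sum_i al i w * nc i t w; set Q := \sum_i _ * nc i t w.
have hv := ler_wpM2l (sqr_ge0 (phi w)) (variance_le t w).
have hZ := sqr_ge0 Z.
move: hv; rewrite mulrBr => hv.
have -> : (phi w * mu t w + Z) ^+ 2 =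
  phi w ^+ 2 * mu t w ^+ 2 + 2 * phi w * mu t w * Z + Z ^+ 2 by ring.
have <- : phi w ^+ 2 * (4 * q t ^+ 2 * (C w ^+ 2 * (1 - C w ^+ 2))) =
  4 * q t ^+ 2 * (phi w ^+ 2 * (C w ^+ 2 * (1 - C w ^+ 2))) by ring.
lra.
Qed.

Let bdd_C n : (m * s <= n)%N -> bdd n C.
Proof. by move=> mn; apply: bdd_dotv; [exact: bdd_mx_cst|exact: bdd_mx_le mn bdd_a]. Qed.

Let bdd_Phi n : (m * s <= n)%N ->
  bdd n (fun w => phi w ^+ 2 * (C w ^+ 2 * (1 - C w ^+ 2))).
Proof.
move=> mn; have bC := bdd_C mn.
apply: bdd_adaptedM; first exact/bdd_adaptedX/(bdd_adapted_le mn).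
apply: bdd_adaptedM; first exact: bdd_adaptedX.
by apply: bdd_adaptedB; [exact: bdd_adapted_cst|exact: bdd_adaptedX].
Qed.

Let bdd_cross i t : bdd (m * s) (cross i t).
Proof.
have bal k : bdd (m * s) (al k) by exact: bdd_dotv.
apply: bdd_adaptedM => //; apply: bdd_adaptedM; first exact: bdd_adaptedZ.
apply: bdd_adaptedB; first exact: bdd_adapted_cst.
by apply: bdd_adapted_sum => k _; apply: bdd_adaptedZ; exact: bdd_adaptedX.
Qed.

Lemma bdd_noise_coord i t : bdd ((m + t) * s) (nc i t).
Proof. exact: (bdd_sum_e i (fun j => p i (t.-1 - j))). Qed.

Lemma bdd_leading_noise t :
  bdd ((m + t) * s) (fun w => \sum_(j < t) zp ^+ (t.-1 - j) * e i0 j w).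
Proof. exact: (bdd_sum_e i0 (fun j => zp ^+ (t.-1 - j))). Qed.

Let Ex_noise_le t :
  \sum_i E (fun w => nc i t w ^+ 2) <= \sum_(j < t) q (t.-1 - j) ^+ 2 * V j.
Proof.
rewrite /V; under [leRHS]eq_bigr do rewrite mulr_sumr.
rewrite exchange_big/=; apply: ler_sum => i _.
rewrite (Ex_sum_sqr i (fun j => p i (t.-1 - j))); apply: ler_sum => j _.
rewrite ler_wpM2r//; apply: Ex_ge0 => w; exact: sqr_ge0.
Qed.

Let VS t : V t.+1 <=
  eta * (4 * Phi * q t.+1 ^+ 2 + \sum_(j < t.+1) q (t - j) ^+ 2 * V j).
Proof.
apply: le_trans (V_le _) _; rewrite ler_wpM2l//.
  by rewrite divr_ge0 ?sqr_ge0.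
have L := lv t.+1.
have b1 : bdd ((m + t.+1) * s) (fun w =>
    4 * q t.+1 ^+ 2 * (phi w ^+ 2 * (C w ^+ 2 * (1 - C w ^+ 2)))).
  exact/bdd_adaptedZ/bdd_Phi.
have b2 i : bdd ((m + t.+1) * s) (fun w => cross i t.+1 w * nc i t.+1 w).
  apply: bdd_adaptedM; first exact: bdd_adapted_le (bdd_cross i _).
  exact: bdd_noise_coord.
have b2s : bdd ((m + t.+1) * s) (fun w => \sum_i cross i t.+1 w * nc i t.+1 w).
  by apply: bdd_adapted_sum => i _; exact: b2.
have b3 i : bdd ((m + t.+1) * s) (fun w => nc i t.+1 w ^+ 2).
  exact/bdd_adaptedX/bdd_noise_coord.
have b3s : bdd ((m + t.+1) * s) (fun w => \sum_i nc i t.+1 w ^+ 2).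
  by apply: bdd_adapted_sum => i _; exact: b3.
apply: le_trans (Ex_le rX _ (bdd_adaptedD (bdd_adaptedD b1 b2s) b3s) (masked_sqr_le t.+1)) _.
  by apply: bdd_dotv; exact: bdd_v.
rewrite (ExD rX (bdd_adaptedD b1 b2s) b3s) (ExD rX b1 b2s).
rewrite (ExZ rX (n := (m + t.+1) * s)); last exact: bdd_Phi.
rewrite (Ex_sum rX (n := (m + t.+1) * s))// (Ex_sum rX (n := (m + t.+1) * s))//.
rewrite big1 => [|i _]; last first.
  exact: (Ex_mul_sum_e i (fun j => p i (t.+1.-1 - j)) t.+1 (bdd_cross i t.+1)).
rewrite addr0 -/Phi; have -> : 4 * q t.+1 ^+ 2 * Phi = 4 * Phi * q t.+1 ^+ 2 by ring.
by rewrite lerD2l; exact: (Ex_noise_le t.+1).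
Qed.

Let Phi_ge0 : 0 <= Phi.
Proof.
apply: Ex_ge0 => w; rewrite mulr_ge0 ?sqr_ge0// mulr_ge0 ?sqr_ge0//.
by rewrite subr_ge0.
Qed.

Let noise_factor_bound (c : nat -> R) W t : (forall j, 0 <= c j) ->
  (forall j, (j < t)%N -> c j * q j ^+ 2 * D ^+ 2 <= W) ->
  \sum_(j < t) c j * V j <= W * (4 * Phi) * ((1 + h) ^+ t.-1 - 1).
Proof.
apply: (weighted_noise b0 blam V0 _ _ VS).
  by rewrite divr_ge0 ?sqr_ge0.
by rewrite mulr_ge0.
Qed.

Lemma Ex_noise_energy t :
  E (fun w => (\sum_i nc i t w ^+ 2) / q t ^+ 2) <=
  4 * ((1 + h) ^+ t.-1 - 1) * Phi.
Proof.
have q2 : 0 < q t ^+ 2 by rewrite exprn_gt0// cheb_gt0.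
have bn i : bdd ((m + t) * s) (fun w => nc i t w ^+ 2).
  exact/bdd_adaptedX/bdd_noise_coord.
have -> : (fun w => (\sum_i nc i t w ^+ 2) / q t ^+ 2) =
    fun w => (q t ^+ 2)^-1 * \sum_i nc i t w ^+ 2.
  by apply/funext => w; rewrite mulrC.
rewrite (ExZ rX (n := (m + t) * s)); last exact: bdd_adapted_sum.
rewrite (Ex_sum rX (n := (m + t) * s))// mulrC ler_pdivrMr//.
apply: le_trans (Ex_noise_le t) _.
have -> : 4 * ((1 + h) ^+ t.-1 - 1) * Phi * q t ^+ 2 =
  q t ^+ 2 * (4 * Phi) * ((1 + h) ^+ t.-1 - 1) by ring.
apply: (noise_factor_bound (c := fun j => q (t.-1 - j) ^+ 2)) => [j|j jt].
  exact: sqr_ge0.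
have := cheb_weight_le b0 blam (t.-1 - j) j.
by case: t q2 bn jt => // t _ _ jt; rewrite subnK.
Qed.

(** Same accumulation with propagator z_+^(t-1-j) in place of q_{t-1-j}: the weight condition holds
    with W = z_+^(2t) because q_j D <= z_+^(j+1). *)
Lemma Ex_leading_noise t :
  E (fun w => (\sum_(j < t) zp ^+ (t.-1 - j) * e i0 j w) ^+ 2 / (zp ^+ t) ^+ 2) <=
  4 * ((1 + h) ^+ t.-1 - 1) * Phi.
Proof.
have z0 : 0 < zp := zplus_gt0 b0 blam.
have z2 : 0 < (zp ^+ t) ^+ 2 by rewrite !exprn_gt0.
have -> : (fun w => (\sum_(j < t) zp ^+ (t.-1 - j) * e i0 j w) ^+ 2 / (zp ^+ t) ^+ 2)
  = fun w => ((zp ^+ t) ^+ 2)^-1 * (\sum_(j < t) zp ^+ (t.-1 - j) * e i0 j w) ^+ 2.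
  by apply/funext => w; rewrite mulrC.
rewrite (ExZ rX (n := (m + t) * s)); last first.
  exact: bdd_adaptedX (bdd_sum_e i0 (fun j => zp ^+ (t.-1 - j)) t).
rewrite (Ex_sum_sqr i0 (fun j => zp ^+ (t.-1 - j))) mulrC ler_pdivrMr//.
apply: (@le_trans _ _ (\sum_(j < t) (zp ^+ (t.-1 - j)) ^+ 2 * V j)).
  apply: ler_sum => j _; rewrite ler_wpM2l ?sqr_ge0// /V (bigD1 i0)//= lerDl.
  by apply: sumr_ge0 => i _; apply: Ex_ge0 => w; exact: sqr_ge0.
have -> : 4 * ((1 + h) ^+ t.-1 - 1) * Phi * (zp ^+ t) ^+ 2 =
  (zp ^+ t) ^+ 2 * (4 * Phi) * ((1 + h) ^+ t.-1 - 1) by ring.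
apply: (noise_factor_bound (c := fun j => (zp ^+ (t.-1 - j)) ^+ 2)) => [j|j jt].
  exact: sqr_ge0.
have -> : (zp ^+ (t.-1 - j)) ^+ 2 * q j ^+ 2 * D ^+ 2 =
  (zp ^+ (t.-1 - j) * (q j * D)) ^+ 2 by ring.
have qD : 0 <= q j * D.
  by rewrite mulr_ge0// ltW ?cheb_gt0// cheb_gap_gt0.
rewrite ler_sqr ?nnegrE; last 2 first.
- by rewrite mulr_ge0// exprn_ge0// ltW.
- by rewrite exprn_ge0// ltW.
apply: le_trans (ler_wpM2l (exprn_ge0 _ (ltW z0)) (cheb_le_zplus b0 blam j)) _.
by rewrite -/zp -exprD; have -> : (t.-1 - j + j.+1)%N = t by lia.
Qed.

End epoch_moments.

(** * From one anchor to the next, pathwise *)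

Definition tan2 {R : realType} (c : R) : R := (1 - c ^+ 2) / c ^+ 2.

Lemma vr_inner_unit {R : realType} {d : nat} (A : 'M[R]_d) (beta : R)
    (M : nat -> 'M[R]_d) (a : 'cV[R]_d) (T : nat) :
  (0 < T)%N -> let v := (vr_inner A beta M a T).2 in v != 0 -> dotv v v = 1.
Proof.
case: T => // t _; rewrite /= /vr_step /=; move: (_ - beta *: _) => w'.
have [->|w0] := eqVneq w' 0; first by rewrite scaler0 eqxx.
move=> _; have n0 : norm2 w' != 0 by rewrite norm2_eq0.
by rewrite dotvZl dotvZr -norm2_sqr; field.
Qed.

Section epoch_step.
Context {R : realType} {d : nat}.
Variables (A : 'M[R]_d) (lambda : 'I_d -> R) (u : 'I_d -> 'cV[R]_d) (i0 : 'I_d).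
Variable b : R.
Hypothesis symA : A^T = A.
Hypothesis eigA : forall i, A *m u i = lambda i *: u i.
Hypothesis ou : orthonormal_family u.
Hypotheses (b0 : 0 <= b) (blam : 2 * b < lambda i0).
Hypothesis lambda_small : forall i, i != i0 -> 0 <= lambda i <= 2 * b.
Variables (M : nat -> 'M[R]_d) (a : 'cV[R]_d) (phi : R) (T : nat).
Let u1 := u i0.
Let C := dotv u1 a.
Hypotheses (a1 : dotv a a = 1) (C0 : 0 < C).
Hypotheses (phi_gt0 : 0 < phi) (T_gt0 : (0 < T)%N).
Hypothesis ratio : forall i, i != i0 ->
  cheb (b ^+ 2) (lambda i) T ^+ 2 <= 593 / 1000 * cheb (b ^+ 2) (lambda i0) T ^+ 2.

Let N t := M t - A.
Let Y := stopped A lambda u i0 b N a (phi *: a).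
Let W := (\sum_i noise_coord A lambda u i0 b N a phi i T ^+ 2) /
  cheb (b ^+ 2) (lambda i0) T ^+ 2.
Let W3 := (\sum_(j < T) zplus (lambda i0) b ^+ (T.-1 - j) *
   dotv u1 (N j *m masked lambda u i0 b a (Y j))) ^+ 2 /
  (zplus (lambda i0) b ^+ T) ^+ 2.
Let a' := (vr_inner A (b ^+ 2) M a T).2.
Let C' := dotv u1 a'.

Let W_ge0 : 0 <= W.
Proof. by rewrite divr_ge0 ?sqr_ge0// sumr_ge0// => i _; exact: sqr_ge0. Qed.

Let W3_ge0 : 0 <= W3. Proof. by rewrite divr_ge0 ?sqr_ge0. Qed.

Let C_le1 : C ^+ 2 <= 1.
Proof.
have := one_sub_leading_coord i0 ou a1; rewrite -/u1 -/C => H.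
by rewrite -subr_ge0 H sumr_ge0// => i _; exact: sqr_ge0.
Qed.

Let coords : 0 < leading lambda u i0 b (Y T) ->
  let X0 := dotv u1 (Y T).2 in
  let Sp := \sum_(i | i != i0) dotv (u i) (Y T).2 ^+ 2 in
  [/\ 0 < X0, 0 < C', C' ^+ 2 = X0 ^+ 2 / (X0 ^+ 2 + Sp) & 0 <= Sp].
Proof.
move=> lT X0 Sp; have X0_gt0 : 0 < X0 := leading_gt0_coord symA eigA b0 blam lT.
have Sp0 : 0 <= Sp by apply: sumr_ge0 => i _; exact: sqr_ge0.
have [c c0 [inE /(_ T_gt0) n1]] := vr_inner_stopped symA eigA b0 blam phi_gt0 lT.
have C'E : C' = c * X0 by rewrite /C' /a' inE /= dotvZr.
have : c ^+ 2 * (X0 ^+ 2 + Sp) = 1.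
  have -> : X0 ^+ 2 + Sp = dotv (Y T).2 (Y T).2.
    rewrite (dotv_orthonormal ou) (bigD1 i0)//= expr2; congr (_ + _).
  by have := norm2_sqr (c *: (Y T).2); rewrite n1 expr1n dotvZl dotvZr mulrA -expr2.
have XS : 0 < X0 ^+ 2 + Sp by rewrite ltr_wpDr// exprn_gt0.
move=> H; split=> //; first by rewrite C'E mulr_gt0.
rewrite C'E exprMn; apply/(mulIf (lt0r_neq0 XS)).
by rewrite divfK ?gt_eqF// mulrAC H mul1r.
Qed.

(** If the growing mode is still positive, the new anchor is the normalized stopped iterate and
    [contraction_step] applies. Otherwise the two processes may have separated, but the new squared
    tangent is at most 1 and [W3] alone dominates phi^2 C^2. *)
Lemma survive_step : 0 < C' -> 1 / 2 <= C' ^+ 2 ->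
  phi ^+ 2 * C ^+ 2 * tan2 C' <=
  72 / 100 * (phi ^+ 2 * (1 - C ^+ 2)) + 121 / 10 * W + W3.
Proof.
move=> C'0 C'2; have [l0|l0] := leP (leading lambda u i0 b (Y T)) 0.
  have H := stopping_step symA eigA b0 blam C0 phi_gt0 l0.
  have t1 : tan2 C' <= 1 by rewrite /tan2 ler_pdivrMr ?exprn_gt0//; lra.
  have pC : 0 <= phi ^+ 2 * C ^+ 2 by rewrite mulr_ge0 ?sqr_ge0.
  apply: (@le_trans _ _ (phi ^+ 2 * C ^+ 2)); first by rewrite ler_piMr.
  apply: le_trans H _; rewrite -/W3 lerDr; apply: addr_ge0; last exact: mulr_ge0.
  by apply: mulr_ge0 => //; apply: mulr_ge0; [exact: sqr_ge0|rewrite subr_ge0].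
have [X00 _ C'E Sp0] := coords l0.
have X2 : 0 < dotv u1 (Y T).2 ^+ 2 by rewrite exprn_gt0.
move: C'E C'2; set Sp := \sum_(_ | _) _ in Sp0 *; set X0 := dotv u1 _ in X00 X2 * => C'E.
have XS : 0 < X0 ^+ 2 + Sp by rewrite ltr_wpDr.
rewrite C'E ler_pdivlMr// => C'2.
have SX : Sp <= X0 ^+ 2 by lra.
have -> : tan2 C' = Sp / X0 ^+ 2.
  by rewrite /tan2 C'E; field; rewrite !gt_eqF.
have := contraction_step symA eigA ou b0 blam a1 ratio X00 SX.
by move=> H; apply: le_trans H _; rewrite lerDl.
Qed.

(** A run is lost either because the growing mode vanished, which [W3] pays for, or because the new
    anchor is more than 45 degrees away from u_1, which is the case of [escape_step]. *)
Lemma death_step : ~ (0 < C' /\ 1 / 2 <= C' ^+ 2) ->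
  phi ^+ 2 * (C ^+ 2 - 771 / 1000 * (1 - C ^+ 2)) <= 26 / 3 * W + W3.
Proof.
move=> dead; have [l0|l0] := leP (leading lambda u i0 b (Y T)) 0.
  have H := stopping_step symA eigA b0 blam C0 phi_gt0 l0.
  apply: (@le_trans _ _ (phi ^+ 2 * C ^+ 2)).
    apply: ler_wpM2l; first exact: sqr_ge0.
    have := C_le1; lra.
  by apply: le_trans H _; rewrite -/W3; have := W_ge0; lra.
have [X00 C'0 C'E Sp0] := coords l0.
move: C'E; set Sp := \sum_(_ | _) _ in Sp0 *; set X0 := dotv u1 _ in X00 * => C'E.
have X2 : 0 < X0 ^+ 2 by rewrite exprn_gt0.
have XS : 0 < X0 ^+ 2 + Sp by rewrite ltr_wpDr.
have SX : X0 ^+ 2 < Sp.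
  rewrite ltNge; apply/negP => SX; apply: dead; split; first exact: C'0.
  by rewrite C'E ler_pdivlMr; [lra|exact: XS].
have := escape_step symA eigA ou b0 blam a1 ratio X00 SX.
by move=> H; apply: le_trans H _; rewrite lerDl.
Qed.

End epoch_step.

(** * Consequences of the epoch length and the batch size *)

Section parameters.
Context {R : realType}.
Variables (lam b c delta : R).
Hypotheses (b0 : 0 <= b) (blam : 2 * b < lam).
Hypotheses (c01 : 0 < c < 1 / 16) (delta01 : 0 < delta < 1).
Let L := ln (1 / (c * delta)).
Let D := cheb_gap lam b.
Let T := epoch_length (b ^+ 2) lam c delta.

Let cd16 : 0 < c * delta <= 1 / 16.
Proof.
have /andP[c0 c1] := c01; have /andP[d0 d1] := delta01.
rewrite mulr_gt0//= (le_trans _ (ltW c1))// ler_piMr// ltW//.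
Qed.

Lemma log_ge : 27 / 10 <= L. Proof. exact: ln16_le. Qed.

Let D0 : 0 < D. Proof. exact: cheb_gap_gt0. Qed.
Let z := b / D * L.

Let z_ge0 : 0 <= z.
Proof. by rewrite !mulr_ge0 ?invr_ge0 ?(ltW D0)//; have := log_ge; lra. Qed.

Let TE : T = maxn 1 `|Num.ceil z|%N.
Proof. by rewrite /T /epoch_length sqrtr_sqr ger0_norm. Qed.

Lemma epoch_length_gt0 : (0 < T)%N.
Proof. by rewrite TE leq_max. Qed.

Let ceilE : `|Num.ceil z|%N%:R = (Num.ceil z)%:~R :> R.
Proof.
by rewrite natr_absz ger0_norm// ceil_ge0; have := z_ge0; lra.
Qed.

Lemma epoch_length_ge : b * L <= T%:R * D.
Proof.
rewrite -ler_pdivrMr// mulrAC -/z (le_trans (ceil_ge z))// -ceilE ler_nat TE.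
exact: leq_maxr.
Qed.

(** Rounding up costs less than one step, and the noise-free first step pays for it; when the
    maximum with 1 is active, [T.-1] is 0. *)
Lemma epoch_length_pred_le : T.-1%:R <= z.
Proof.
have [->|Tn0] := eqVneq T.-1 0%N; first exact: z_ge0.
have TC : T = `|Num.ceil z|%N.
  move: Tn0; rewrite TE; case: (`|Num.ceil z|%N) => [|[|k]] //=.
rewrite -subn1 natrB ?epoch_length_gt0// TC ceilE ltW//.
by have := ceilB1_lt z; rewrite intrB.
Qed.

Lemma noise_growth_le (n : nat) (sigma : R) (s : nat) :
  (0 < s)%N -> (2 <= n)%N ->
  32 * Num.sqrt n%:R * b * sigma ^+ 2 /
    (c * (lam ^+ 2 - 4 * b ^+ 2) `^ (3 / 2) * delta) * L <= s%:R ->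
  4 * ((1 + sigma ^+ 2 / s%:R / D ^+ 2) ^+ T.-1 - 1) <= delta / 180.
Proof.
move=> s0 n2 Hs; have /andP[c0 c1] := c01; have /andP[d0 d1] := delta01.
have sp : 0 < s%:R :> R by rewrite ltr0n.
set h := sigma ^+ 2 / s%:R / D ^+ 2.
have h0 : 0 <= h by rewrite !divr_ge0 ?sqr_ge0// ler0n.
have powE : (lam ^+ 2 - 4 * b ^+ 2) `^ (3 / 2) = D ^+ 3.
  rewrite -(cheb_gap_sqr b0 blam) -/D -(powR_mulrn 2 (ltW D0)) -powRrM.
  have -> : 2%:R * (3 / 2) = 3%:R :> R by field.
  by rewrite powR_mulrn// ltW.
(* A rational lower bound for sqrt 2 with 32 (721/512) = 721/16; the remaining factor 16 comes from
   c < 1/16, whence the 721 below. *)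
have sq2 : 721 / 512 <= Num.sqrt n%:R :> R.
  have q0 : 0 <= 721 / 512 :> R by lra.
  rewrite -[leLHS](ger0_norm q0) -sqrtr_sqr ler_sqrt ?ler0n//.
  have n2R : 2%:R <= n%:R :> R by rewrite ler_nat.
  lra.
move: epoch_length_pred_le; move: T.-1 => k kz.
have nh : k%:R * h <= delta / 721.
  have D3 : 0 < D ^+ 3 by rewrite exprn_gt0.
  have cD : 0 < c * D ^+ 3 * delta by rewrite !mulr_gt0.
  have sn : 0 < Num.sqrt n%:R :> R by apply: lt_le_trans sq2; lra.
  move: Hs; rewrite powE mulrAC ler_pdivrMr// => Hs.
  apply: (@le_trans _ _ (z * h)); first by rewrite ler_wpM2r.
  have -> : z * h = b * sigma ^+ 2 * L / (s%:R * D ^+ 3).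
    by rewrite /z /h; field; rewrite !gt_eqF.
  rewrite ler_pdivrMr ?mulr_gt0//.
  have H1 : 32 * Num.sqrt n%:R * (b * sigma ^+ 2 * L) <= s%:R * D ^+ 3 * (c * delta).
    by move: Hs; lra.
  have B0 : 0 <= b * sigma ^+ 2 * L.
    have L0 : 0 <= L by have := log_ge; lra.
    by apply: mulr_ge0 => //; apply: mulr_ge0 => //; exact: sqr_ge0.
  have H2 : 721 / 16 * (b * sigma ^+ 2 * L) <=
      32 * Num.sqrt n%:R * (b * sigma ^+ 2 * L).
    by rewrite ler_wpM2r//; lra.
  have H3 : s%:R * D ^+ 3 * (c * delta) <= s%:R * D ^+ 3 * (delta / 16).
    by rewrite ler_wpM2l ?mulr_ge0 ?(ltW sp) ?(ltW D3)//; nra.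
  have := le_trans H2 (le_trans H1 H3); lra.
(* (1 + h)^k <= exp(kh) <= 1/(1 - kh). With kh <= delta/721 and delta < 1 this yields (1 + h)^k - 1
   <= delta/720, and 4/720 = 1/180. *)
have pw : (1 + h) ^+ k * (1 - k%:R * h) <= 1.
  have e1 : (1 + h) ^+ k <= expR (k%:R * h).
    by rewrite expRM_natl lerXn2r ?nnegrE ?expR_ge0 ?addr_ge0// expR_ge1Dx.
  have e2 : 1 - k%:R * h <= expR (- (k%:R * h)) by exact: expR_ge1Dx.
  rewrite -[leRHS](expRxMexpNx_1 (k%:R * h)); apply: ler_pM => //.
    by rewrite exprn_ge0// addr_ge0.
  by lra.
have p0 : 0 <= (1 + h) ^+ k by rewrite exprn_ge0// addr_ge0.
set Q := (1 + h) ^+ k in pw p0 *.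
have h1 : Q * (1 - delta / 721) <= 1.
  by apply: le_trans pw; rewrite ler_wpM2l//; lra.
have : (Q - 1) * (1 - delta / 721) <= delta / 721 by rewrite mulrBl mul1r; lra.
have [Q1|Q1] := leP Q 1; first by move=> _; lra.
move=> H; nra.
Qed.

End parameters.

(** * Induction over the epochs *)

Section adapted_algorithm.
Context {R : realType} {dT : measure_display} {Omega : measurableType dT}.
Variables (P : probability Omega R) (d : nat) (X : nat -> Omega -> 'M[R]_d).

(** Measurability is kept apart from boundedness here: normalization inverts a norm that may be
    arbitrarily small. Boundedness of the anchors is recovered afterwards from their norm being at
    most 1. *)
Definition adapted_mx n p q (M : Omega -> 'M[R]_(p, q)) :=
  forall i j, adapted X n (fun w => M w i j).

Lemma bdd_mx_adapted n p q (M : Omega -> 'M[R]_(p, q)) :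
  bdd_mx P X n M -> adapted_mx n M.
Proof. by move=> bM i j; have [] := bM i j. Qed.

Lemma adapted_mxB n p q (M N : Omega -> 'M[R]_(p, q)) :
  adapted_mx n M -> adapted_mx n N -> adapted_mx n (fun w => M w - N w).
Proof.
move=> mM mN i j; rewrite /adapted; under eq_fun do rewrite !mxE.
by apply: measurable_funB; [exact: mM|exact: mN].
Qed.

Lemma adapted_mxD n p q (M N : Omega -> 'M[R]_(p, q)) :
  adapted_mx n M -> adapted_mx n N -> adapted_mx n (fun w => M w + N w).
Proof.
move=> mM mN i j; rewrite /adapted; under eq_fun do rewrite mxE.
by apply: measurable_funD; [exact: mM|exact: mN].
Qed.

Lemma adapted_mxZ n p q (f : Omega -> R) (M : Omega -> 'M[R]_(p, q)) :
  adapted X n f -> adapted_mx n M -> adapted_mx n (fun w => f w *: M w).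
Proof.
move=> mf mM i j; rewrite /adapted; under eq_fun do rewrite mxE.
by apply: measurable_funM; [exact: mf|exact: mM].
Qed.

Lemma adapted_mxM n p q k (M : Omega -> 'M[R]_(p, q)) (N : Omega -> 'M[R]_(q, k)) :
  adapted_mx n M -> adapted_mx n N -> adapted_mx n (fun w => M w *m N w).
Proof.
move=> mM mN i j; rewrite /adapted; under eq_fun do rewrite mxE.
by apply: measurable_sum => l; apply: measurable_funM; [exact: mM|exact: mN].
Qed.

Lemma adapted_mx_le m n p q (M : Omega -> 'M[R]_(p, q)) :
  (m <= n)%N -> adapted_mx m M -> adapted_mx n M.
Proof. by move=> mn mM i j; exact: adapted_le mn (mM i j). Qed.

Lemma adapted_dotv n p (x y : Omega -> 'cV[R]_p) :
  adapted_mx n x -> adapted_mx n y -> adapted X n (fun w => dotv (x w) (y w)).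
Proof.
move=> mx my; rewrite /adapted; under eq_fun do rewrite dotvE.
by apply: measurable_sum => l; apply: measurable_funM; [exact: mx|exact: my].
Qed.

Lemma adapted_inv n f : (forall w, 0 <= f w) -> adapted X n f ->
  adapted X n (fun w => (f w)^-1).
Proof.
move=> f0 mf; have -> : (fun w => (f w)^-1) = (@powR R ^~ (-1)) \o f.
  by apply/funext => w; rewrite /= powR_inv1.
by apply: adapted_comp => //; exact: measurable_powR.
Qed.

Lemma adapted_norm2 n p (x : Omega -> 'cV[R]_p) :
  adapted_mx n x -> adapted X n (fun w => norm2 (x w)).
Proof.
move=> mx; apply: (@adapted_comp _ _ _ _ _ n (@Num.sqrt R)).
  by apply: continuous_measurable_fun; exact: sqrt_continuous.
exact: adapted_dotv.
Qed.

Lemma adapted_vr_inner (A : 'M[R]_d) (beta : R) (s m : nat)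
    (M : nat -> Omega -> 'M[R]_d) (a : Omega -> 'cV[R]_d) :
  adapted_mx (m * s) a -> (forall t, adapted_mx ((m + t.+1) * s) (M t)) ->
  forall t, let v w := vr_inner A beta (M ^~ w) (a w) t in
  adapted_mx ((m + t) * s) (fun w => (v w).1) /\
  adapted_mx ((m + t) * s) (fun w => (v w).2).
Proof.
move=> ma mM; elim=> [|t [IH1 IH2]] /=.
  rewrite addn0; split; last exact: ma.
  by move=> i j; exact: (measurable_cst ((0 : 'cV[R]_d) i j)).
have lt : ((m + t) * s <= (m + t.+1) * s)%N by rewrite leq_mul2r leq_add2l leqnSn orbT.
have {}IH1 := adapted_mx_le lt IH1; have {}IH2 := adapted_mx_le lt IH2.
have {}ma : adapted_mx ((m + t.+1) * s) a.
  by apply: adapted_mx_le ma; rewrite leq_mul2r leq_addr orbT.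
have mc p q (N : 'M[R]_(p, q)) : adapted_mx ((m + t.+1) * s) (fun=> N).
  by move=> i j; exact: measurable_cst.
pose v w := vr_inner A beta (M ^~ w) (a w) t.
pose w' w := M t w *m ((v w).2 - dotv (v w).2 (a w) *: a w) +
  dotv (v w).2 (a w) *: (A *m a w) - beta *: (v w).1.
have mw' : adapted_mx ((m + t.+1) * s) w'.
  have mal := adapted_dotv IH2 ma.
  apply: adapted_mxB; last by apply: adapted_mxZ => //; exact: measurable_cst.
  apply: adapted_mxD.
    by apply: adapted_mxM => //; apply: adapted_mxB => //; exact: adapted_mxZ.
  by apply: adapted_mxZ => //; exact: adapted_mxM.
have mn : adapted X ((m + t.+1) * s) (fun w => (norm2 (w' w))^-1).
  by apply: adapted_inv; [move=> w; exact: norm2_ge0|exact: adapted_norm2].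
by split; exact: adapted_mxZ.
Qed.

End adapted_algorithm.

Section epochs.
Context {R : realType} {dT : measure_display} {Omega : measurableType dT}.
Variables (P : probability Omega R) (d : nat) (X : nat -> Omega -> 'M[R]_d).
Variables (A : 'M[R]_d) (r sigma : R).
Hypothesis iidX : iid P X.
Hypothesis meanX : forall k, mx_mean P (X k) A.
Hypothesis boundX : forall k, {ae P, forall w, spectral_norm (X k w) <= r}.
Hypothesis varX : forall k,
  ('E_P[fun w => (spectral_norm (X k w - A) ^+ 2)%R] = (sigma ^+ 2)%:E)%E.
Variables (lambda : 'I_d -> R) (u : 'I_d -> 'cV[R]_d) (i0 : 'I_d) (b : R).
Hypothesis symA : A^T = A.
Hypothesis eigA : forall i, A *m u i = lambda i *: u i.
Hypothesis ou : orthonormal_family u.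
Hypotheses (b0 : 0 <= b) (blam : 2 * b < lambda i0).
Hypothesis lambda_small : forall i, i != i0 -> 0 <= lambda i <= 2 * b.
Variable s : nat.
Hypothesis s_gt0 : (0 < s)%N.
Variables (T : nat) (w0 : 'cV[R]_d) (delta : R).
Hypothesis T_gt0 : (0 < T)%N.
Let u1 := u i0.
Hypotheses (w0_unit : dotv w0 w0 = 1) (w0_pos : 0 < dotv u1 w0).
Hypothesis w0_half : 1 / 2 <= dotv u1 w0 ^+ 2.
Hypothesis ratio : forall i, i != i0 ->
  cheb (b ^+ 2) (lambda i) T ^+ 2 <= 593 / 1000 * cheb (b ^+ 2) (lambda i0) T ^+ 2.
Hypothesis delta01 : 0 < delta < 1.
Hypothesis noise_small :
  4 * ((1 + sigma ^+ 2 / s%:R / cheb_gap (lambda i0) b ^+ 2) ^+ T.-1 - 1)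
  <= delta / 180.

Local Notation bdd := (bdd_adapted P X).
Local Notation E := (Ex P).
Let rX n : random_mx (X n). Proof. by have [] := iidX. Qed.

Definition iterate k w := vr_power A (b ^+ 2) T s (fun j => X j w) w0 k.
Let good (x : R) := (0 < x) && (1 / 2 <= x ^+ 2).

Fixpoint alive k w : bool :=
  if k is k'.+1 then alive k' w && good (dotv u1 (iterate k w)) else true.

Let al k w : R := (alive k w)%:R.
(** Lost runs are redirected to u_1, so that the anchor is a unit vector with C^2 >= 1/2 at every
    sample point, as the one-epoch moment bounds require. *)
Let anchor k w := if alive k w then iterate k w else u1.
Let C k w := dotv u1 (anchor k w).
Let t2 k w := tan2 (C k w).
Let lvl k := (k * T * s)%N.

Let u1_unit : dotv u1 u1 = 1. Proof. by rewrite ou eqxx. Qed.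

Let iterate_norm k w : dotv (iterate k w) (iterate k w) <= 1.
Proof.
case: k => [|k]; first by rewrite /iterate /= w0_unit.
have [->|n0] := eqVneq (iterate k.+1 w) 0; first by rewrite dotv0r.
by rewrite (vr_inner_unit T_gt0 n0).
Qed.

Let alive_spec k w : alive k w ->
  [/\ dotv (iterate k w) (iterate k w) = 1, 0 < dotv u1 (iterate k w) &
      1 / 2 <= dotv u1 (iterate k w) ^+ 2].
Proof.
case: k => [|k] //= /andP[_ /andP[c0 c2]]; split => //.
apply: vr_inner_unit => //; apply/eqP => y0.
by move: c0; rewrite /iterate /= y0 dotv0r ltxx.
Qed.

Let anchor_unit k w : dotv (anchor k w) (anchor k w) = 1.
Proof. by rewrite /anchor; case: ifPn => // /alive_spec[]. Qed.

Let C_gt0 k w : 0 < C k w.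
Proof. by rewrite /C /anchor; case: ifPn => [/alive_spec[]//|_]; rewrite u1_unit. Qed.

Let C_half k w : 1 / 2 <= C k w ^+ 2.
Proof.
rewrite /C /anchor; case: ifPn => [/alive_spec[]//|_].
by rewrite u1_unit expr1n; lra.
Qed.

Let C_le1 k w : C k w ^+ 2 <= 1.
Proof.
rewrite -(anchor_unit k w) (dotv_orthonormal ou) (bigD1 i0)//= -/u1 -/(C k w) expr2.
by rewrite lerDl sumr_ge0// => i _; rewrite -expr2 sqr_ge0.
Qed.

Let alive_decr k w : alive k.+1 w -> alive k w. Proof. by move=> /= /andP[]. Qed.

Let bdd_batch m : bdd_mx P X (m.+1 * s) (fun w => batch_mean s (fun j => X j w) m).
Proof.
have -> : (fun w => batch_mean s (fun j => X j w) m) =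
    fun w => batch_noise X A s m w + A.
  by apply/funext => w; rewrite /batch_noise subrK.
apply: bdd_mxD; last exact: bdd_mx_cst.
by apply: bdd_batch_noise.
Qed.

Let iterate_adapted k : adapted_mx X (lvl k) (iterate k).
Proof.
elim: k => [|k IH]; first by move=> i j; exact: measurable_cst.
have mB t : adapted_mx X ((k * T + t.+1) * s)
    (fun w => batch_mean s (fun j => X j w) (k * T + t)).
  by rewrite addnS; apply: bdd_mx_adapted; exact: bdd_batch.
have := (adapted_vr_inner A (b ^+ 2) IH mB T).2.
by rewrite /lvl mulSn addnC.
Qed.

Let bdd_iterate k : bdd_mx P X (lvl k) (iterate k).
Proof.
move=> i j; rewrite ord1; split; first exact: iterate_adapted.
exists 1; apply: aeW => w; apply: le_trans (entry_le_norm2 _ _) _.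
by rewrite -[leRHS]sqrtr1 ler_sqrt.
Qed.

Let lvl_le k : (lvl k <= lvl k.+1)%N.
Proof. by rewrite /lvl leq_mul2r leq_mul2r leqnSn !orbT. Qed.

Let bdd_al k : bdd (lvl k) (al k).
Proof.
elim: k => [|k IH]; first exact: bdd_adapted_cst.
have bc : bdd (lvl k.+1) (fun w => dotv u1 (iterate k.+1 w)).
  by apply: bdd_dotv; [exact: bdd_mx_cst|exact: bdd_iterate].
pose c w := dotv u1 (iterate k.+1 w).
(* The non-strict condition is written as the complement of a strict one, to fit
   [bdd_adapted_pos]. *)
have -> : al k.+1 = fun w => al k w * ((0 < c w)%R%:R *
    (1 - (0 < 1 / 2 - c w ^+ 2)%R%:R)).
  apply/funext => w; rewrite /al [alive k.+1 w]/= /good -/(c w) subr_gt0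
    [c w ^+ 2 < _]ltNge.
  by case: (alive k w); case: (0 < c w); case: (1 / 2 <= c w ^+ 2);
    rewrite /= ?subr0 ?subrr ?mulr1 ?mulr0 ?mul0r.
apply: bdd_adaptedM; first exact: bdd_adapted_le (lvl_le k) IH.
apply: bdd_adaptedM; first by apply: bdd_adapted_pos; have [] := bc.
apply: bdd_adaptedB; first exact: bdd_adapted_cst.
apply: bdd_adapted_pos.
have : bdd (lvl k.+1) (fun w => 1 / 2 - c w ^+ 2).
  by apply: bdd_adaptedB; [exact: bdd_adapted_cst|exact: bdd_adaptedX].
by case.
Qed.

Let bdd_anchor k : bdd_mx P X (lvl k) (anchor k).
Proof.
have -> : anchor k = fun w => al k w *: iterate k w + (1 - al k w) *: u1.
  apply/funext => w; rewrite /anchor /al; case: (alive k w) => /=.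
    by rewrite subrr scale0r addr0 scale1r.
  by rewrite subr0 scale0r add0r scale1r.
apply: bdd_mxD; first by apply: bdd_mxZ => //; exact: bdd_al.
apply: bdd_mxZ; last exact: bdd_mx_cst.
by apply: bdd_adaptedB; [exact: bdd_adapted_cst|exact: bdd_al].
Qed.

Let bdd_C k : bdd (lvl k) (C k).
Proof. by apply: bdd_dotv; [exact: bdd_mx_cst|exact: bdd_anchor]. Qed.

Let bdd_Cinv k : bdd (lvl k) (fun w => (C k w)^-1).
Proof.
split; last first.
  exists 2; apply: aeW => w; have c0 := C_gt0 k w; have c2 := C_half k w.
  rewrite ger0_norm ?invr_ge0 ?(ltW c0)// -[leRHS]invrK lef_pV2 ?posrE ?invr_gt0//.
  by rewrite expr2 in c2; nra.
apply: adapted_inv; first by move=> w; exact: ltW (C_gt0 k w).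
by have [] := bdd_C k.
Qed.

Let t2E k w : t2 k w = (C k w)^-1 ^+ 2 - 1.
Proof. by rewrite /t2 /tan2; field; rewrite gt_eqF. Qed.

Let bdd_t2 k : bdd (lvl k) (t2 k).
Proof.
have -> : t2 k = fun w => (C k w)^-1 ^+ 2 - 1 by apply/funext => w; exact: t2E.
by apply: bdd_adaptedB; [exact: bdd_adaptedX|exact: bdd_adapted_cst].
Qed.

Let t2_ge0 k w : 0 <= t2 k w.
Proof. by rewrite divr_ge0 ?sqr_ge0// subr_ge0. Qed.

Let t2_le1 k w : t2 k w <= 1.
Proof. by rewrite ler_pdivrMr ?exprn_gt0//; have := C_half k w; lra. Qed.

Let C2t k w : C k w ^+ 2 * (1 + t2 k w) = 1.
Proof. by rewrite /t2 /tan2; field; rewrite gt_eqF. Qed.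

Let al_sqr k w : al k w ^+ 2 = al k w.
Proof. by rewrite /al; case: (alive k w); rewrite ?expr1n ?expr0n. Qed.

Section one_epoch.
Variables (k : nat) (g : Omega -> R).
Hypotheses (bdd_g : bdd (lvl k) g) (g_gt0 : forall w, 0 < g w).
(** On surviving runs phi C = g, so the signal in the pathwise bounds is g^2; on lost runs phi = 0.
    The choice g = 1 serves the contraction, a larger g the survival probability. *)
Let phi w := al k w * (g w * (C k w)^-1).

Let bdd_phi : bdd (lvl k) phi.
Proof. by apply: bdd_adaptedM => //; exact: bdd_adaptedM. Qed.

Definition epoch_energy w := (\sum_i noise_coord A lambda u i0 b
  (epoch_noise X A s (k * T) ^~ w) (anchor k w) (phi w) i T ^+ 2) /
  cheb (b ^+ 2) (lambda i0) T ^+ 2.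

Definition epoch_leading w := (\sum_(j < T) zplus (lambda i0) b ^+ (T.-1 - j) *
   dotv u1 (epoch_noise X A s (k * T) j w *m
     masked lambda u i0 b (anchor k w)
       (epoch_path X A lambda u i0 b s (k * T) (anchor k) phi j w))) ^+ 2 /
  (zplus (lambda i0) b ^+ T) ^+ 2.

Let PhiE : (fun w => phi w ^+ 2 * (C k w ^+ 2 * (1 - C k w ^+ 2))) =
  fun w => al k w * (g w ^+ 2 * (1 - C k w ^+ 2)).
Proof.
apply/funext => w; rewrite -[al k w in RHS]al_sqr /phi.
by field; rewrite gt_eqF.
Qed.

Let nu_le (x : R) : 0 <= x ->
  4 * ((1 + sigma ^+ 2 / s%:R / cheb_gap (lambda i0) b ^+ 2) ^+ T.-1 - 1) * x
  <= delta / 180 * x.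
Proof. by move=> x0; rewrite ler_wpM2r. Qed.

Let Phi_ge0 : 0 <= E (fun w => al k w * (g w ^+ 2 * (1 - C k w ^+ 2))).
Proof.
apply: Ex_ge0 => w; rewrite mulr_ge0// mulr_ge0 ?sqr_ge0// subr_ge0.
exact: C_le1.
Qed.

Lemma Ex_epoch_energy : E epoch_energy <=
  delta / 180 * E (fun w => al k w * (g w ^+ 2 * (1 - C k w ^+ 2))).
Proof.
apply: le_trans (nu_le Phi_ge0); rewrite -PhiE.
exact: (Ex_noise_energy iidX meanX boundX varX symA eigA ou b0 blam lambda_small
  s_gt0 (bdd_anchor k) bdd_phi (anchor_unit k) (C_half k)).
Qed.

Lemma Ex_epoch_leading : E epoch_leading <=
  delta / 180 * E (fun w => al k w * (g w ^+ 2 * (1 - C k w ^+ 2))).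
Proof.
apply: le_trans (nu_le Phi_ge0); rewrite -PhiE.
exact: (Ex_leading_noise iidX meanX boundX varX symA eigA ou b0 blam lambda_small
  s_gt0 (bdd_anchor k) bdd_phi (anchor_unit k) (C_half k)).
Qed.


Lemma bdd_epoch_energy : bdd (lvl k.+1) epoch_energy.
Proof.
have bn i := bdd_noise_coord A boundX lambda u i0 b s_gt0 (bdd_anchor k) bdd_phi i T.
apply: bdd_adaptedM; last exact: bdd_adapted_cst.
apply: bdd_adapted_sum => i _; apply: bdd_adaptedX.
by have := bn i; rewrite /lvl mulSn [(T + _)%N]addnC.
Qed.

Lemma bdd_epoch_leading : bdd (lvl k.+1) epoch_leading.
Proof.
apply: bdd_adaptedM; last exact: bdd_adapted_cst.
apply: bdd_adaptedX.
have := bdd_leading_noise A boundX lambda u i0 b s_gt0 (bdd_anchor k) bdd_phi T.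
by rewrite /lvl mulSn [(T + _)%N]addnC.
Qed.

Let epoch_energy_ge0 w : 0 <= epoch_energy w.
Proof. by rewrite divr_ge0 ?sqr_ge0// sumr_ge0// => i _; exact: sqr_ge0. Qed.

Let epoch_leading_ge0 w : 0 <= epoch_leading w.
Proof. by rewrite divr_ge0 ?sqr_ge0. Qed.

Let M w t := batch_mean s (fun j => X j w) (k * T + t).

Let phiE w : alive k w -> phi w = g w / C k w.
Proof. by rewrite /phi /al => ->; rewrite mul1r. Qed.

Let phi_gt0 w : alive k w -> 0 < phi w.
Proof. by move=> aw; rewrite phiE// divr_gt0. Qed.

Let iterateE w : alive k w ->
  (vr_inner A (b ^+ 2) (M w) (anchor k w) T).2 = iterate k.+1 w.
Proof. by rewrite /anchor => ->. Qed.

Let C_next w : alive k.+1 w -> C k.+1 w = dotv u1 (iterate k.+1 w).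
Proof. by rewrite /C /anchor => ->. Qed.

Lemma alive_contraction w : g w = 1 ->
  al k.+1 w * t2 k.+1 w <=
  72 / 100 * (al k w * t2 k w) + (121 / 10 * epoch_energy w + epoch_leading w).
Proof.
move=> g1; have [aw'|naw'] := boolP (alive k.+1 w); last first.
  rewrite {1}/al (negbTE naw') mul0r addr_ge0//.
    by apply: mulr_ge0 => //; apply: mulr_ge0.
  by apply: addr_ge0 => //; apply: mulr_ge0.
have aw := alive_decr aw'; have [_ c0 c2] := alive_spec aw'.
have : phi w ^+ 2 * C k w ^+ 2 * t2 k.+1 w <=
    72 / 100 * (phi w ^+ 2 * (1 - C k w ^+ 2)) + 121 / 10 * epoch_energy w +
    epoch_leading w.
  rewrite /t2 C_next// -iterateE//.
  apply: (survive_step (M := M w) symA eigA ou b0 blam (anchor_unit k w) (C_gt0 k w)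
    (phi_gt0 aw) T_gt0 ratio); by rewrite iterateE.
move: (epoch_energy w) (epoch_leading w) => W W3.
rewrite phiE// g1 /al aw aw' !mul1r addrA.
have Cn := lt0r_neq0 (C_gt0 k w).
have -> : (C k w)^-1 ^+ 2 * C k w ^+ 2 = 1 by field.
have -> : (C k w)^-1 ^+ 2 * (1 - C k w ^+ 2) = t2 k w by rewrite /t2 /tan2; field.
by rewrite mul1r.
Qed.

(* The weight g makes the left-hand side of [death_step] at least 1 uniformly in
   the angle while keeping the noise energy proportional to tan2. *)
Lemma alive_death w : g w = 1 + 11 / 10 * t2 k w ->
  al k w - al k.+1 w <= 26 / 3 * epoch_energy w + epoch_leading w.
Proof.
move=> gE; have R0 : 0 <= 26 / 3 * epoch_energy w + epoch_leading w.
  by apply: addr_ge0 => //; apply: mulr_ge0.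
have [aw|naw] := boolP (alive k w); last first.
  rewrite {1}/al (negbTE naw) sub0r; apply: le_trans R0.
  by rewrite oppr_le0.
have [aw'|naw'] := boolP (alive k.+1 w); first by rewrite /al aw aw' subrr.
have nC : ~ (0 < dotv u1 (iterate k.+1 w) /\ 1 / 2 <= dotv u1 (iterate k.+1 w) ^+ 2).
  by move=> [c0 c2]; move: naw'; rewrite /= aw /good c0 c2.
have : phi w ^+ 2 * (C k w ^+ 2 - 771 / 1000 * (1 - C k w ^+ 2)) <=
    26 / 3 * epoch_energy w + epoch_leading w.
  apply: (death_step (M := M w) symA eigA ou b0 blam (anchor_unit k w) (C_gt0 k w)
    (phi_gt0 aw) T_gt0 ratio).
  by rewrite iterateE.
apply: le_trans; rewrite phiE// /al aw (negbTE naw') subr0 gE.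
have Cn := lt0r_neq0 (C_gt0 k w).
set t := t2 k w.
have -> : ((1 + 11 / 10 * t) / C k w) ^+ 2 *
    (C k w ^+ 2 - 771 / 1000 * (1 - C k w ^+ 2)) =
    (1 + 11 / 10 * t) ^+ 2 * (1 - 771 / 1000 * t).
  by rewrite /t /t2 /tan2; field.
have t0 : 0 <= t := t2_ge0 k w; have t1 : t <= 1 := t2_le1 k w.
(* The product expands to 1 + 1.429 t - 0.4862 t^2 - 0.93291 t^3, which is at least 1 + 0.00989 t
   once t^2 and t^3 are replaced by t. *)
have h2 : t ^+ 2 <= t by rewrite expr2 ler_piMl.
have h3 : t ^+ 3 <= t by rewrite exprS ler_piMr// (le_trans h2).
rewrite /=; lra.
Qed.

End one_epoch.

Let tau k := E (fun w => al k w * t2 k w).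

Let bdd_alt k : bdd (lvl k) (fun w => al k w * t2 k w).
Proof. exact: bdd_adaptedM. Qed.

Let tau_ge0 k : 0 <= tau k.
Proof. by apply: Ex_ge0 => w; exact: mulr_ge0. Qed.

Let defect_le k w : 1 - C k w ^+ 2 <= t2 k w.
Proof. by have := C2t k w; have := C_le1 k w; have := t2_ge0 k w; nra. Qed.

Let bdd_defect k (g : Omega -> R) : bdd (lvl k) g ->
  bdd (lvl k) (fun w => al k w * (g w ^+ 2 * (1 - C k w ^+ 2))).
Proof.
move=> bg; apply: bdd_adaptedM => //; apply: bdd_adaptedM; first exact: bdd_adaptedX.
by apply: bdd_adaptedB; [exact: bdd_adapted_cst|exact: bdd_adaptedX].
Qed.

Let Ex_defect_le k (g : Omega -> R) (x : R) : bdd (lvl k) g ->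
  (forall w, g w ^+ 2 * (1 - C k w ^+ 2) <= x * t2 k w) ->
  E (fun w => al k w * (g w ^+ 2 * (1 - C k w ^+ 2))) <= x * tau k.
Proof.
move=> bg gx; rewrite -(ExZ rX _ (bdd_alt k)); apply: (Ex_le rX (n := lvl k)).
- exact: bdd_defect.
- exact: bdd_adaptedZ.
- by move=> w; rewrite [leRHS]mulrCA ler_wpM2l.
Qed.

Let one_defect_le k w : 1 ^+ 2 * (1 - C k w ^+ 2) <= 1 * t2 k w.
Proof. by rewrite expr1n !mul1r. Qed.

Let Z k w := 121 / 10 * epoch_energy k (fun=> 1) w + epoch_leading k (fun=> 1) w.

Let bdd_one k : bdd (lvl k) (fun=> 1). Proof. exact: bdd_adapted_cst. Qed.

Let bdd_Z k : bdd (lvl k.+1) (Z k).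
Proof.
apply: bdd_adaptedD; first exact/bdd_adaptedZ/bdd_epoch_energy.
exact: bdd_epoch_leading.
Qed.

Let Z_ge0 k w : 0 <= Z k w.
Proof.
apply: addr_ge0; last by rewrite divr_ge0 ?sqr_ge0.
apply: mulr_ge0 => //.
by rewrite divr_ge0 ?sqr_ge0// sumr_ge0// => i _; exact: sqr_ge0.
Qed.

(** (121/10 + 1)/180 < 8/100. Added to the contraction factor 72/100, and with delta < 1, this gives
    the rate 8/10 of [tau_le]. *)
Let Ex_Z k : E (Z k) <= delta * (8 / 100) * tau k.
Proof.
have be := bdd_epoch_energy (bdd_one k); have bl := bdd_epoch_leading (bdd_one k).
rewrite (ExD rX (bdd_adaptedZ _ be) bl) (ExZ rX _ be).
have h1 := Ex_epoch_energy (bdd_one k); have h2 := Ex_epoch_leading (bdd_one k).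
have h3 := Ex_defect_le (bdd_one k) (one_defect_le k).
have /andP[d0 _] := delta01; have d180 : 0 <= delta / 180 by lra.
have h4 := ler_wpM2l d180 h3; have t0 := tau_ge0 k.
have dt : 0 <= delta * tau k by apply: mulr_ge0 => //; exact: ltW.
lra.
Qed.

Let contraction k w : al k.+1 w * t2 k.+1 w <= 72 / 100 * (al k w * t2 k w) + Z k w.
Proof. exact: alive_contraction. Qed.

Let tau_le k : tau k <= (8 / 10) ^+ k.
Proof.
elim: k => [|k IH].
  rewrite expr0 -[leRHS](Ex_cst P); apply: (Ex_le rX (bdd_alt 0) (bdd_one 0)) => w.
  by rewrite /al /= mul1r.
have bt := bdd_adapted_le (lvl_le k) (bdd_alt k).
apply: (@le_trans _ _ (72 / 100 * tau k + E (Z k))).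
  rewrite -(ExZ rX _ bt) -(ExD rX (bdd_adaptedZ _ bt) (bdd_Z k)).
  apply: (Ex_le rX (bdd_alt k.+1)); last exact: contraction.
  exact: bdd_adaptedD (bdd_adaptedZ _ bt) (bdd_Z k).
have hz := Ex_Z k; have t0 := tau_ge0 k; have /andP[d0 d1] := delta01.
have dt : delta * tau k <= tau k by rewrite ler_piMl// ltW.
rewrite exprS; move: IH; set e := _ ^+ k; lra.
Qed.

Let pos (x : R) : R := (0 < x)%R%:R * x.

Let pos_ge0 x : 0 <= pos x.
Proof. by rewrite /pos; case: ltP => [/ltW h|_]; rewrite ?mul1r ?mul0r. Qed.

Let le_pos x : x <= pos x.
Proof. by rewrite /pos; case: ltP => [_|h]; rewrite ?mul1r ?mul0r. Qed.

(** The threshold is what the squared tangent of a surviving run would be bounded by without noise,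
    so any excess is due to [Z] and carries the factor delta needed for the final application of
    Markov's inequality. *)
Let excess k w := al k w * pos (t2 k w - (72 / 100) ^+ k).

Let bdd_excess k : bdd (lvl k) (excess k).
Proof.
have bx : bdd (lvl k) (fun w => t2 k w - (72 / 100) ^+ k).
  by apply: bdd_adaptedB => //; exact: bdd_adapted_cst.
apply: bdd_adaptedM => //; apply: bdd_adaptedM => //.
by apply: bdd_adapted_pos; have [] := bx.
Qed.

Let excess_step k w : excess k.+1 w <= 72 / 100 * excess k w + Z k w.
Proof.
rewrite /excess; have [aw'|naw'] := boolP (alive k.+1 w); last first.
  rewrite {1}/al (negbTE naw') mul0r; apply: addr_ge0 => //.
  by apply: mulr_ge0 => //; apply: mulr_ge0.
have aw := alive_decr aw'; have := contraction k w.
rewrite /al aw aw' !mul1r exprS {1}/pos; case: ltP => h; rewrite ?mul1r ?mul0r.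
  by have := le_pos (t2 k w - (72 / 100) ^+ k); lra.
move=> _; apply: addr_ge0 => //; exact: mulr_ge0.
Qed.

(** The right-hand side solves x_{k+1} = (72/100) x_k + (8/100) delta (8/10)^k with x_0 = 0 exactly,
    as 8/10 - 72/100 = 8/100. *)
Let Ex_excess k : E (excess k) <= delta * ((8 / 10) ^+ k - (72 / 100) ^+ k).
Proof.
have /andP[d0 _] := delta01.
elim: k => [|k IH].
  rewrite !expr0 subrr mulr0 -[leRHS](Ex_cst P).
  apply: (Ex_le rX (bdd_excess 0) (bdd_adapted_cst _ _ _ _)) => w.
  rewrite /excess /pos expr0; case: ltP => h; last by rewrite mul0r mulr0.
  by have := t2_le1 0 w; move: h; lra.
have be := bdd_adapted_le (lvl_le k) (bdd_excess k).
apply: (@le_trans _ _ (72 / 100 * E (excess k) + E (Z k))).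
  rewrite -(ExZ rX _ be) -(ExD rX (bdd_adaptedZ _ be) (bdd_Z k)).
  apply: (Ex_le rX (bdd_excess k.+1)); last exact: excess_step.
  exact: bdd_adaptedD (bdd_adaptedZ _ be) (bdd_Z k).
have hz := Ex_Z k; have ht := tau_le k.
have dt : delta * tau k <= delta * (8 / 10) ^+ k by rewrite ler_wpM2l// ltW.
rewrite !exprS; move: IH dt; set e := (8 / 10) ^+ k; set f := (72 / 100) ^+ k; lra.
Qed.

Let g2 k w := 1 + 11 / 10 * t2 k w.

Let bdd_g2 k : bdd (lvl k) (g2 k).
Proof. by apply: bdd_adaptedD; [exact: bdd_adapted_cst|exact: bdd_adaptedZ]. Qed.

Let g2_gt0 k w : 0 < g2 k w.
Proof. by rewrite /g2; have := t2_ge0 k w; lra. Qed.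

(** With t the squared tangent, 1 - C^2 = C^2 t and C^2 (1 + t) = 1, so it suffices that (1 +
    11t/10)^2 <= (221/100)(1 + t) on [0, 1]. *)
Let g2_defect_le k w : g2 k w ^+ 2 * (1 - C k w ^+ 2) <= 221 / 100 * t2 k w.
Proof.
have SE : 1 - C k w ^+ 2 = C k w ^+ 2 * t2 k w.
  by rewrite /t2 /tan2; field; rewrite gt_eqF.
have h : g2 k w ^+ 2 <= 221 / 100 * (1 + t2 k w).
  have t0 := t2_ge0 k w; have t1 := t2_le1 k w.
  by rewrite /g2 expr2; nra.
rewrite SE mulrA ler_wpM2r// mulrC.
apply: le_trans (ler_wpM2l (sqr_ge0 _) h) _.
by rewrite mulrCA C2t mulr1.
Qed.

(** (26/3 + 1)(221/100)/180 < 12/100. The geometric series of these losses sums to (12/100)/(1 -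
    8/10) = 6/10, the constant in [Ex_alive]. *)
Let alive_loss k : E (al k) - E (al k.+1) <= delta * (12 / 100) * (8 / 10) ^+ k.
Proof.
have b1 := bdd_adapted_le (lvl_le k) (bdd_al k).
have b2 := bdd_adaptedZ (-1) (bdd_al k.+1).
have be := bdd_epoch_energy (bdd_g2 k); have bl := bdd_epoch_leading (bdd_g2 k).
have beZ := bdd_adaptedZ (26 / 3) be.
have -> : E (al k) - E (al k.+1) = E (fun w => al k w + (-1) * al k.+1 w).
  by rewrite (ExD rX b1 b2) (ExZ rX _ (bdd_al k.+1)) mulN1r.
apply: (@le_trans _ _ (E (fun w => 26 / 3 * epoch_energy k (g2 k) w +
    epoch_leading k (g2 k) w))).
  apply: (Ex_le rX (bdd_adaptedD b1 b2) (bdd_adaptedD beZ bl)) => w.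
  by rewrite mulN1r; apply: alive_death.
rewrite (ExD rX beZ bl) (ExZ rX _ be).
have h1 := Ex_epoch_energy (bdd_g2 k); have h2 := Ex_epoch_leading (bdd_g2 k).
have h3 := Ex_defect_le (bdd_g2 k) (g2_defect_le k).
have /andP[d0 _] := delta01; have d180 : 0 <= delta / 180 by lra.
have h4 := ler_wpM2l d180 h3; have h5 := tau_le k.
have h6 : delta * tau k <= delta * (8 / 10) ^+ k by rewrite ler_wpM2l// ltW.
have h7 : 0 <= delta * tau k by apply: mulr_ge0 => //; exact: ltW.
move: h6; set e := _ ^+ k; lra.
Qed.

Let Ex_alive k : 1 - delta * (6 / 10) * (1 - (8 / 10) ^+ k) <= E (al k).
Proof.
elim: k => [|k IH].
  by rewrite expr0 subrr mulr0 subr0 -[leLHS](Ex_cst P).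
have := alive_loss k; rewrite exprS; move: IH; set e := _ ^+ k; lra.
Qed.

Lemma vr_power_accuracy (K : nat) (eps : R) :
  0 < eps -> (8 / 10) ^+ K <= eps / 100 ->
  ((1 - 27 / 40 * delta)%:E <=
   P [set w | (1 - dotv u1 (iterate K w) ^+ 2 <= eps)%R])%E.
Proof.
move=> e0 Ke; set S := [set w | _]; have /andP[d0 d1] := delta01.
pose c w := dotv u1 (iterate K w).
have bc : bdd (lvl K) c.
  by apply: bdd_dotv; [exact: bdd_mx_cst|exact: bdd_iterate].
pose f w : R := 1 - (0 < (1 - c w ^+ 2) - eps)%R%:R.
have bf : bdd (lvl K) f.
  apply: bdd_adaptedB; first exact: bdd_adapted_cst.
  apply: bdd_adapted_pos.
  have : bdd (lvl K) (fun w => (1 - c w ^+ 2) - eps).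
    apply: bdd_adaptedB; last exact: bdd_adapted_cst.
    by apply: bdd_adaptedB; [exact: bdd_adapted_cst|exact: bdd_adaptedX].
  by case.
have fS : f = \1_S.
  apply/funext => w; rewrite /f indicE subr_gt0 ltNge.
  have -> : (w \in S) = (1 - c w ^+ 2 <= eps).
    by apply/idP/idP; rewrite inE.
  by case: (_ <= eps); rewrite /= ?subr0 ?subrr.
have mf := adapted_measurable rX bf.1.
have mS : measurable S.
  have -> : S = f @^-1` [set 1].
    apply/seteqP; split => w /=; rewrite fS indicE.
      by move=> Sw; rewrite mem_set.
    have [|_ /eqP] := boolP (w \in S); first by rewrite inE.
    by rewrite eq_sym oner_eq0.
  by rewrite -[X in measurable X]setTI; apply: mf => //; exact: measurable_set1.
have EfS : (E f)%:E = P S.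
  by rewrite /Ex /Rintegral fS integral_indic// setIT fineK// fin_num_measure.
rewrite -EfS lee_fin.
have m8 : (72 / 100) ^+ K <= (8 / 10) ^+ K :> R by rewrite lerXn2r ?nnegrE//; lra.
have m0 : 0 <= (72 / 100) ^+ K :> R by rewrite exprn_ge0//; lra.
(* Markov's inequality in pointwise form. A surviving run outside [S] has squared tangent above eps,
   while (72/100)^K <= eps/100, so its excess is at least eps/2. The expectation of the subtracted
   term is at most delta/50. *)
apply: (@le_trans _ _ (E (fun w => al K w - 2 / eps * excess K w))); last first.
  apply: (Ex_le rX _ bf).
    by apply: bdd_adaptedB => //; exact: bdd_adaptedZ.
  move=> w; rewrite fS; have x0 := pos_ge0 (t2 K w - (72 / 100) ^+ K).
  have [aw|naw] := boolP (alive K w); last first.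
    by rewrite /excess /al (negbTE naw) mul0r mulr0 subrr indicE ler0n.
  rewrite indicE; have [Sw|nSw] := boolP (w \in S).
    rewrite /excess /al aw mul1r gerBl mulr_ge0// divr_ge0// ltW//.
  have cE : c w = C K w by rewrite /c /C /anchor aw.
  have : eps < 1 - c w ^+ 2.
    by rewrite ltNge; apply/negP => h; move/negP: nSw; apply; rewrite inE.
  rewrite cE => h; have := defect_le K w => h'.
  have hp := le_pos (t2 K w - (72 / 100) ^+ K).
  rewrite /excess /al aw mul1r subr_le0.
  have -> : true%:R = 2 / eps * (eps / 2) :> R.
    by rewrite -[true%:R]/(1 : R); field; rewrite gt_eqF.
  rewrite ler_wpM2l//; first by rewrite divr_ge0// ltW.
  lra.
have bK := bdd_excess K.
have -> : E (fun w => al K w - 2 / eps * excess K w) =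
    E (al K) - 2 / eps * E (excess K).
  have -> : (fun w => al K w - 2 / eps * excess K w) =
      fun w => al K w + (- (2 / eps)) * excess K w.
    by apply/funext => w; rewrite mulNr.
  by rewrite (ExD rX (bdd_al K) (bdd_adaptedZ _ bK)) (ExZ rX _ bK) mulNr.
have ha := Ex_alive K; have hx := Ex_excess K.
have e2 : 0 <= 2 / eps by rewrite divr_ge0// ltW.
have h1 : 2 / eps * E (excess K) <= 2 / eps * (delta * (eps / 100)).
  rewrite ler_wpM2l//; apply: le_trans hx _; rewrite ler_wpM2l ?(ltW d0)//; lra.
have h2 : 2 / eps * (delta * (eps / 100)) = delta / 50 by field; rewrite gt_eqF.
have h3 : 0 <= delta * (8 / 10) ^+ K.
  by apply: mulr_ge0; [exact: ltW|apply: exprn_ge0; lra].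
lra.
Qed.

End epochs.

(** * The number of epochs and the final statement *)

Section epoch_count.
Context {R : realType}.

(** For eps >= 1/2 the initial vector is accurate with certainty. Running no epoch is also what the
    bounds call for there: as eps tends to 1, log(1/eps) tends to 0 and allows neither one epoch nor
    a failure budget of (27/40) delta. *)
Definition epoch_count (eps : R) : nat :=
  if 1 / 2 <= eps then 0%N else `|Num.ceil (40 * ln (1 / eps))|%N.

Let ln_ge (eps : R) : 0 < eps < 1 / 2 -> 27 / 40 <= ln (1 / eps).
Proof.
move=> /andP[e0 e1]; apply: le_trans ln2_ge _.
by rewrite ler_ln ?posrE ?divr_gt0// ler_pdivlMr//; lra.
Qed.

(** Rounding up adds less than 1, which is below 2 log(1/eps) when eps < 1/2; hence 42 = 40 + 2. *)
Lemma epoch_count_le (eps : R) : 0 < eps < 1 ->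
  (epoch_count eps)%:R <= 42 * ln (1 / eps).
Proof.
move=> /andP[e0 e1]; rewrite /epoch_count; have [_|eh] := leP (1 / 2) eps.
  by apply: mulr_ge0 => //; rewrite ln_ge0// ler_pdivlMr// mul1r ltW.
have l0 := ln_ge (introT andP (conj e0 eh)).
rewrite natr_absz ger0_norm; last by rewrite ceil_ge0; lra.
by have := ceilB1_lt (40 * ln (1 / eps)); rewrite intrB; lra.
Qed.

(** 8/10 <= exp(-2/10), so 40 log(1/eps) epochs give at most eps^8 = eps eps^7, and eps^7 <= 1/128 <
    1/100. *)
Lemma epoch_count_contraction (eps : R) : 0 < eps < 1 / 2 ->
  (8 / 10) ^+ epoch_count eps <= eps / 100.
Proof.
move=> e01; have l0 := ln_ge e01; have /andP[e0 e1] := e01.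
rewrite /epoch_count ifN -?ltNge//; set K := `|_|%N.
have KL : 40 * ln (1 / eps) <= K%:R.
  by rewrite natr_absz ger0_norm ?ceil_ge// ceil_ge0; lra.
have h8 : 8 / 10 <= expR (- (2 / 10)) :> R.
  by have := @expR_ge1Dx R (- (2 / 10)); lra.
apply: (@le_trans _ _ (expR (- (2 / 10)) ^+ K)).
  by rewrite lerXn2r ?nnegrE ?expR_ge0//; lra.
rewrite -expRM_natl; apply: (@le_trans _ _ (expR (8 * ln eps))).
  rewrite ler_expR; have : ln (1 / eps) = - ln eps by rewrite div1r lnV// posrE.
  by move=> lE; rewrite lE in KL; lra.
rewrite expRM_natl lnK ?posrE// exprS ler_wpM2l ?(ltW e0)//.
apply: (@le_trans _ _ ((1 / 2) ^+ 7)); last lra.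
by rewrite lerXn2r ?nnegrE// ?ltW//; lra.
Qed.

End epoch_count.

Theorem theorem5 (R : realType) :
  exists (C : R) (K : R -> nat),
    [/\ 0 < C,
      forall epsilon : R, 0 < epsilon < 1 ->
        (K epsilon)%:R <= C * ln (1 / epsilon)
    & forall (n : nat) (A : 'M[R]_n.+2)
        (lambda : 'I_n.+2 -> R) (u : 'I_n.+2 -> 'cV[R]_n.+2)
        (dT : measure_display) (Omega : measurableType dT)
        (P : probability Omega R) (X : nat -> Omega -> 'M[R]_n.+2)
        (r sigma beta c delta epsilon : R) (w0 : 'cV[R]_n.+2) (s : nat),
      let lambda1 := lambda (inord 0) in
      let lambda2 := lambda (inord 1) in
      let u1 := u (inord 0) in
      let T := epoch_length beta lambda1 c delta in
      psd A ->
      (forall i, A *m u i = lambda i *: u i) ->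
      orthonormal_family u ->
      (forall i j : 'I_n.+2, (i <= j)%N -> lambda j <= lambda i) ->
      lambda1 <= 1 -> lambda2 < lambda1 -> (forall i, 0 <= lambda i) ->
      iid P X ->
      (forall k, mx_mean P (X k) A) ->
      (forall k, {ae P, forall w, spectral_norm (X k w) <= r}) ->
      (forall k, ('E_P[fun w => (spectral_norm (X k w - A) ^+ 2)%R]
                  = (sigma ^+ 2)%:E)%E) ->
      0 <= beta -> lambda2 <= 2 * Num.sqrt beta < lambda1 ->
      norm2 w0 = 1 -> 1 - (dotv u1 w0) ^+ 2 <= 1 / 2 ->
      0 < c < 1 / 16 -> 0 < delta < 1 -> 0 < epsilon < 1 ->
      (0 < s)%N ->
      32 * Num.sqrt n.+2%:R * Num.sqrt beta * sigma ^+ 2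
        / (c * (lambda1 ^+ 2 - 4 * beta) `^ (3 / 2) * delta)
        * ln (1 / (c * delta)) <= s%:R ->
      ((1 - ln (1 / epsilon) * delta)%:E <=
       P [set w | (1 - (dotv u1 (vr_power A beta T s (fun k => X k w) w0
                                   (K epsilon))) ^+ 2 <= epsilon)%R])%E].
Proof.
exists 42, epoch_count; split => //; first exact: epoch_count_le.
move=> n A lambda u dT Omega P X r sigma beta c delta epsilon w0 s lambda1 lambda2 u1 T.
move=> [symA _] eigA ou mono _ _ lam0 iidX meanX boundX varX beta0 beta_range.
move=> w0n w0u c01 d01 e01 s0.
have [b b0 [betaE sb]] : exists2 b, 0 <= b & beta = b ^+ 2 /\ Num.sqrt beta = b.
  by exists (Num.sqrt beta); [exact: sqrtr_ge0|rewrite sqr_sqrtr].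
subst beta; rewrite sb in beta_range *; move=> s_ge.
have /andP[l2b blam] := beta_range; have /andP[d0 d1] := d01; have /andP[e0 e1] := e01.
have [eh|eh] := leP (1 / 2) epsilon.
  rewrite /epoch_count eh /=.
  have -> : [set _ : Omega | (1 - dotv u1 w0 ^+ 2 <= epsilon)%R] = setT.
    by apply/seteqP; split => // w _ /=; exact: le_trans eh.
  rewrite probability_setT lee_fin gerBl mulr_ge0 ?(ltW d0)//.
  by rewrite ln_ge0// ler_pdivlMr// mul1r ltW.
have lambda_small (i : 'I_n.+2) : i != inord 0 -> 0 <= lambda i <= 2 * b.
  move=> i0; rewrite lam0/=; apply: le_trans l2b; apply: mono.
  rewrite inordK// lt0n; apply: contra i0 => /eqP i00.
  by apply/eqP/val_inj; rewrite /= inordK.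
have T0 : (0 < T)%N by exact: epoch_length_gt0.
have TL := epoch_length_ge b0 blam c01 d01; rewrite -/T in TL.
have noise := noise_growth_le b0 blam c01 d01 s0 (isT : (2 <= n.+2)%N) s_ge.
rewrite -/T in noise.
have ratio (i : 'I_n.+2) : i != inord 0 ->
    cheb (b ^+ 2) (lambda i) T ^+ 2 <= 593 / 1000 * cheb (b ^+ 2) lambda1 T ^+ 2.
  move=> i0; apply: (cheb_ratio b0 blam T0 (log_ge c01 d01) TL).
  exact: lambda_small.
move: T T0 TL noise ratio => T T0 TL noise ratio.
(* Both the hypotheses and the accuracy are even in u1, so u1 may be assumed to
   have positive inner product with w0. *)
have w0h : 1 / 2 <= dotv u1 w0 ^+ 2 by lra.
pose sg := Num.sg (dotv u1 w0).
have sg2 : sg * sg = 1.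
  rewrite -expr2 sqr_sg; have [z|//] := eqVneq (dotv u1 w0) 0.
  by move: w0h; rewrite z expr0n /=; lra.
pose v i := if i == inord 0 then sg *: u i else u i.
have v0 : v (inord 0) = sg *: u1 by rewrite /v eqxx.
have eigv i : A *m v i = lambda i *: v i.
  rewrite /v; case: ifP => _; last exact: eigA.
  by rewrite -scalemxAr eigA !scalerA mulrC.
have ov : orthonormal_family v.
  move=> i j; rewrite /v; case: (eqVneq i (inord 0)) => [->|i0].
    case: (eqVneq j (inord 0)) => [->|j0].
      by rewrite dotvZl dotvZr mulrA sg2 mul1r ou eqxx.
    by rewrite dotvZl ou ![inord 0 == j]eq_sym (negbTE j0) mulr0.
  case: (eqVneq j (inord 0)) => [->|j0]; last exact: ou.
  by rewrite dotvZr ou ?(negbTE i0) mulr0.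
have sqrv y : dotv (v (inord 0)) y ^+ 2 = dotv u1 y ^+ 2.
  by rewrite v0 dotvZl exprMn expr2 sg2 mul1r.
have w0_pos : 0 < dotv (v (inord 0)) w0.
  rewrite v0 dotvZl -/sg /sg -normrEsg normr_gt0; apply/eqP => z.
  by move: w0h; rewrite z expr0n /=; lra.
have w0_half : 1 / 2 <= dotv (v (inord 0)) w0 ^+ 2 by rewrite sqrv.
have w0_unit : dotv w0 w0 = 1 by rewrite -norm2_sqr w0n expr1n.
have eh' : 0 < epsilon < 1 / 2 by rewrite e0.
have := vr_power_accuracy iidX meanX boundX varX symA eigv ov b0 blam lambda_small s0
  T0 w0_unit w0_pos w0_half ratio d01 noise e0 (epoch_count_contraction eh').
under eq_set do rewrite sqrv; apply: le_trans.
rewrite lee_fin lerD2l lerN2 ler_wpM2r ?(ltW d0)//.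
(* In this branch epsilon < 1/2, so log(1/epsilon) is at least log 2 and covers the whole failure
   budget. *)
apply: le_trans ln2_ge _; rewrite ler_ln ?posrE ?divr_gt0// ler_pdivlMr//.
by move: eh; lra.
Qed.
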